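(* Let $k$ be an algebraically closed field of characteristic $p>0$ and let $H$ be a finite-dimensional pointed rank one Hopf algebra over $k$ which is generated as an algebra by $H_1$ and satisfies $H\neq H_0$. Let $a$ be the skew point of $H$. Then precisely one of the following holds: (i) There is some $x\in P_{a,1}\setminus H_0$ such that $axa^{-1}=qx$, where $q$ is a primitive $N$-th root of unity. (ii) There is some $x\in P_{a,1}\setminus H_0$ with $axa^{-1}=x+(a-1)$. Suppose (i) holds. If $q\neq1$, then $H$ is isomorphic to a Hopf algebra $H_R$ with $r=0$. If $q=1$, then $H$ is isomorphic to a Hopf algebra $H_F$. Suppose (ii) holds. Then $p$ divides the order of $a$.
   Context: For a finite-dimensional Hopf algebra $H$ over $k$: $G(H)$ is the group of group-like elements; the coradical $H_0$ is the sum of the simple subcoalgebras; $H_1=\Delta^{-1}(H\otimes H_0+H_0\otimes H)$. $H$ is pointed if all simple subcoalgebras are one-dimensional, so that $H_0=kG(H)$. For $g,h\in G(H)$, $P_{g,h}=\{c\in H:\Delta(c)=c\otimes g+h\otimes c\}$. An element $a\in G(H)$ is a skew point if $P_{a,1}\setminus H_0\neq\emptyset$. A pointed $H$ has rank $t$ if $\dim_k k\otimes_{H_0}H_1=t+1$ ($k$ trivial via the counit). A pointed rank one Hopf algebra has exactly one skew point, and it is central in $G(H)$. First type $H_R$. Let $R=(G,\chi,a,\alpha)$ where $G$ is a finite group, $a\in Z(G)$, $\chi:G\to k^*$ a linear character with $\chi(a)\ne 1$, $\alpha=(\alpha_{-1},\alpha_0,\dots,\alpha_{r-1})\in k^{r+1}$,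 $r\ge 0$. Let $N$ be the order of $\chi(a)$ and $n=p^rN$. It is assumed that $\alpha_{-1}=0$ if $a^n=1$; that if $\alpha_i\ne0$ for some $i\ge0$ then $a^{N(p^r-p^i)}=1$ and $\chi(g)^{N(p^r-p^i)}=1$ for all $g\in G$; and that if $\alpha_{-1}\neq0$ then $\chi(g)^{Np^r}=1$ for all $g\in G$. $H_R$ is the algebra containing $kG$ and an element $x$, with basis $(gx^i)_{g\in G,\,0\le i\le n-1}$ and relations $gxg^{-1}=\chi(g)x$ ($g\in G$), $x^n=\alpha_{-1}(a^n-1)+\sum_{i=0}^{r-1}\alpha_ix^{p^iN}$; its Hopf structure is $\Delta(gx^i)=(g\otimes g)(x\otimes a+1\otimes x)^i$, $\epsilon(gx^i)=\delta_{i,0}$, $S(gx^i)=(-xa^{-1})^ig^{-1}$. Second type $H_F$. Let $F=(G,\chi,c,a,(\alpha_{-1},\alpha_0))$ where $G$ is a finite group, $a\in Z(G)$, $\chi:G\to k^*$ a linear character with $\chi(a)=1$, $c:G\to k$ a map with $c(hg)=\chi(g)c(h)+c(g)$ for all $g,h\in G$ and $c(a)=0$, and $\alpha_{-1},\alpha_0\in k$ with $\alpha_0\in\{0,1\}$ and $\alpha_{-1}=0$ if $\alpha_0=0$. It is assumed that if $\alpha_0=0$ then $c(g)(a^p-1)=0$ in $kG$ for all $g\in G$; and if $\alpha_0=1$ then $a^p=a$, and for all $g\in G$ one has $\chi(g)\in\mathbb{F}_p^*$ and $(\alpha_{-1}(\chi(g)-1)+c(g)^p-c(g))(a-1)=0$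 in $kG$. $H_F$ is the algebra containing $kG$ and an element $x$, with basis $\{gx^i: g\in G,0\le i\le p-1\}$ and relations $x^p=\alpha_{-1}(a^p-1)+\alpha_0x$, $gxg^{-1}=\chi(g)x+c(g)(a-1)$ ($g\in G$); its Hopf structure is $\Delta(gx^i)=(g\otimes g)(x\otimes a+1\otimes x)^i$, $\epsilon(gx^i)=\delta_{i,0}$, $S(gx^i)=(-xa^{-1})^ig^{-1}$.
   Formalization: Case (ii) additionally requires a ≠ 1: for a = 1 (e.g. H = k[x]/(x^p) with x primitive) (i) with q = 1 and (ii) would both hold and p would not divide the order of a; such H are treated under (i). *)

(* Defs.v *)
From HB Require Import structures.
From mathcomp Require Import all_boot all_order all_fingroup all_algebra all_solvable all_field.
From mathcomp Require Import boolp classical_sets.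

Set Implicit Arguments.
Unset Strict Implicit.
Unset Printing Implicit Defensive.

Import GRing.Theory.
Local Open Scope ring_scope.

(** * Tensor products of finite-dimensional vector spaces *)

(* The tensor [t] stands for the sum of the [t i j *: (u_i (x) v_j)], where
   [u] and [v] are the bases [vbasis fullv] of [U] and [V].  The alias keeps
   the matrix product away from [tensor A A], whose product is defined below. *)
Definition tensor (k : fieldType) (U V : vectType k) : Type :=
  'M[k]_(\dim {:U}, \dim {:V}).

HB.instance Definition _ (k : fieldType) (U V : vectType k) :=
  Vector.copy (tensor U V) 'M[k]_(\dim {:U}, \dim {:V}).

Definition tens (k : fieldType) (U V : vectType k) (u : U) (v : V) :
    tensor U V :=
  \matrix_(i, j) (coord (vbasis {:U}) i u * coord (vbasis {:V}) j v).

Declare Scope hopf_scope.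
Delimit Scope hopf_scope with hopf.
Reserved Notation "u *t v" (at level 35, right associativity).
Notation "u *t v" := (tens u v) : hopf_scope.
Local Open Scope hopf_scope.

(* The linear map induced by the bilinear map [f] (see [tlift_tens]). *)
Definition tlift (k : fieldType) (U V W : vectType k) (f : U -> V -> W)
    (t : tensor U V) : W :=
  \sum_i \sum_j (t : 'M_(_, _)) i j *: f (vbasis {:U})`_i (vbasis {:V})`_j.

Definition bilinear_map (k : fieldType) (U V W : vectType k)
    (f : U -> V -> W) : Prop :=
  (forall v, linear (f^~ v)) /\ (forall u, linear (f u)).

Section TensorTheory.
Context {k : fieldType} {U V W : vectType k}.
Implicit Types (u : U) (v : V) (s t : tensor U V) (f : U -> V -> W).

Lemma tens_bilinear : bilinear_map (@tens k U V).
Proof.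
split=> [v c u1 u2|u c v1 v2]; apply/matrixP=> i j; rewrite !mxE linearP /=.
  by rewrite mulrDl mulrA.
by rewrite mulrDr mulrCA.
Qed.

Lemma tlift_linear f : linear (tlift f).
Proof.
move=> c s t; rewrite /tlift scaler_sumr -big_split; apply: eq_bigr => i _ /=.
rewrite scaler_sumr -big_split; apply: eq_bigr => j _ /=.
by rewrite !mxE scalerDl scalerA.
Qed.
HB.instance Definition _ f :=
  GRing.isLinear.Build k (tensor U V) W _ (tlift f) (tlift_linear f).

Lemma tlift_tens f u v : bilinear_map f -> tlift f (u *t v) = f u v.
Proof.
case=> fl fr.
pose gl y := HB.pack_for {linear U -> W} (f^~ y)
  (GRing.isLinear.Build k U W _ (f^~ y) (fl y)).
pose gr x := HB.pack_for {linear V -> W} (f x)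
  (GRing.isLinear.Build k V W _ (f x) (fr x)).
rewrite {2}(coord_vbasis (memvf u)) -[RHS]/(gl v _) linear_sum /tlift.
apply: eq_bigr => i _; rewrite linearZ /=.
rewrite {2}(coord_vbasis (memvf v)) -[f _ _]/(gr _ _) linear_sum scaler_sumr.
by apply: eq_bigr => j _; rewrite linearZ mxE scalerA.
Qed.

Lemma tensor_ind (P : tensor U V -> Prop) :
    (forall u v, P (u *t v)) ->
    (forall c s t, P s -> P t -> P (c *: s + t)) ->
  forall t, P t.
Proof.
move=> Ptens Plin t.
have P0 : P 0.
  have -> : 0 = (-1) *: (0 *t 0) + (0 *t 0) :> tensor U V.
    by rewrite scaleN1r addNr.
  by apply: Plin.
have -> : t = \sum_i \sum_j
    (t : 'M_(_, _)) i j *: ((vbasis {:U})`_i *t (vbasis {:V})`_j).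
  rewrite {1}[t](@matrix_sum_delta k); apply: eq_bigr => i _.
  apply: eq_bigr => j _; congr (_ *: _); apply/matrixP=> a b.
  by rewrite !mxE !coord_free ?(basis_free (vbasisP _)) // -natrM mulnb !(eq_sym _ a) !(eq_sym _ b).
elim/big_rec: _ => // i s _ Ps.
elim/big_rec: _ => [|j r _ Pr]; first by rewrite add0r.
by rewrite -addrA; apply: Plin.
Qed.

End TensorTheory.


Section TensorMorph.
Context {k : fieldType} {U V : vectType k}.

Fact tens_linearl (v : V) : linear ((@tens k U V)^~ v).
Proof. exact: (@tens_bilinear k U V).1. Qed.

Fact tens_linearr (u : U) : linear (@tens k U V u).
Proof. exact: (@tens_bilinear k U V).2. Qed.
HB.instance Definition _ u :=
  GRing.isLinear.Build k V (tensor U V) _ _ (tens_linearr u).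

End TensorMorph.

(** * The algebra structure of [tensor A B] *)

Section TensorAlgebra.
Context {k : fieldType} {A B : falgType k}.
Implicit Types s t u : tensor A B.

Definition tmul s t : tensor A B :=
  tlift (fun a b => tlift (fun a' b' => (a * a') *t (b * b')) t) s.

Let inner_bilin (a : A) (b : B) :
  bilinear_map (fun (a' : A) (b' : B) => (a * a') *t (b * b')).
Proof.
split=> [y c x1 x2|x c y1 y2]; rewrite mulrDr -scalerAr.
  exact: tens_linearl.
exact: tens_linearr.
Qed.

Fact tmul_linearr s : linear (tmul s).
Proof.
move=> c t u; rewrite /tmul {1 3 5}/tlift scaler_sumr -big_split.
apply: eq_bigr => i _ /=; rewrite scaler_sumr -big_split; apply: eq_bigr => j _ /=.
by rewrite tlift_linear scalerDr !scalerA mulrC.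
Qed.

Fact tmul_linearl t : linear (tmul^~ t).
Proof. exact: tlift_linear. Qed.

Lemma tmul_tens (a a' : A) (b b' : B) :
  tmul (a *t b) (a' *t b') = (a * a') *t (b * b').
Proof.
have comb (f g h : A -> B -> tensor A B) c t :
    (forall x y, f x y = c *: g x y + h x y) ->
  tlift f t = c *: tlift g t + tlift h t.
  move=> fE; rewrite /tlift scaler_sumr -big_split; apply: eq_bigr => i _ /=.
  rewrite scaler_sumr -big_split; apply: eq_bigr => j _ /=.
  by rewrite fE scalerDr !scalerA mulrC.
rewrite /tmul tlift_tens; first by rewrite tlift_tens.
split=> [y c x1 x2|x c y1 y2]; apply: comb => p q; rewrite mulrDl -scalerAl.
  exact: tens_linearl.
exact: tens_linearr.
Qed.

Fact tmulA : associative tmul.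
Proof.
move=> s t u; elim/(@tensor_ind k A B): s => [a b|c s1 s2 h1 h2]; last first.
  by rewrite !(tmul_linearl _ c) h1 h2.
elim/(@tensor_ind k A B): t => [a' b'|c s1 s2 h1 h2]; last first.
  by rewrite tmul_linearl !(tmul_linearr _ c) tmul_linearl h1 h2.
elim/(@tensor_ind k A B): u => [a'' b''|c s1 s2 h1 h2]; last first.
  by rewrite !(tmul_linearr _ c) h1 h2.
by rewrite !tmul_tens !mulrA.
Qed.

Fact tmul1t : left_id (1 *t 1) tmul.
Proof.
elim/(@tensor_ind k A B)=> [a b|c s1 s2 h1 h2]; first by rewrite tmul_tens !mul1r.
by rewrite tmul_linearr h1 h2.
Qed.

Fact tmult1 : right_id (1 *t 1) tmul.
Proof.
elim/(@tensor_ind k A B)=> [a b|c s1 s2 h1 h2]; first by rewrite tmul_tens !mulr1.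
by rewrite tmul_linearl h1 h2.
Qed.

Fact tmulDl : left_distributive tmul +%R.
Proof. by move=> s t u; have := tmul_linearl u 1 s t; rewrite !scale1r. Qed.

Fact tmulDr : right_distributive tmul +%R.
Proof. by move=> s t u; have := tmul_linearr s 1 t u; rewrite !scale1r. Qed.

Fact tens11_neq0 : 1 *t 1 != 0 :> tensor A B.
Proof.
have nz (C : falgType k) : exists i, coord (vbasis {:C}) i 1 != 0.
  apply/existsP; apply: contraT; rewrite negb_exists => /forallP h.
  have /eqP[] := oner_neq0 C; rewrite (coord_vbasis (memvf (1 : C))).
  by apply: big1 => i _; move: (h i); rewrite negbK => /eqP->; rewrite scale0r.
have [[i hi] [j hj]] := (nz A, nz B).
apply/eqP => /matrixP/(_ i j); rewrite !mxE => /eqP.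
by rewrite mulf_eq0 (negPf hi) (negPf hj).
Qed.

HB.instance Definition _ := GRing.Zmodule_isNzRing.Build (tensor A B)
  tmulA tmul1t tmult1 tmulDl tmulDr tens11_neq0.

Fact tensor_scalerAl (c : k) s t : c *: (s * t) = (c *: s) * t.
Proof.
have := tmul_linearl t c s 0; rewrite /= addr0 => E; apply/esym; apply: etrans E _.
by rewrite -[tmul 0 t]/((0 : tensor A B) * t) mul0r addr0.
Qed.
Fact tensor_scalerAr (c : k) s t : c *: (s * t) = s * (c *: t).
Proof.
have := tmul_linearr s c t 0; rewrite /= addr0 => E; apply/esym; apply: etrans E _.
by rewrite -[tmul s 0]/(s * (0 : tensor A B)) mulr0 addr0.
Qed.

HB.instance Definition _ :=
  GRing.Lmodule_isLalgebra.Build k (tensor A B) tensor_scalerAl.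
HB.instance Definition _ :=
  GRing.Lalgebra_isAlgebra.Build k (tensor A B) tensor_scalerAr.
HB.instance Definition _ := Algebra_isFalgebra.Build k (tensor A B).

Lemma tensM (a a' : A) (b b' : B) :
  (a *t b) * (a' *t b') = (a * a') *t (b * b').
Proof. exact: tmul_tens. Qed.

End TensorAlgebra.

Definition tmap (k : fieldType) (U U' V V' : vectType k)
    (f : U -> U') (g : V -> V') : tensor U V -> tensor U' V' :=
  tlift (fun u v => f u *t g v).

(* The span of the [u (x) v], i.e., the image of [S (x) T] in [U (x) V]. *)
Definition tensv (k : fieldType) (U V : vectType k)
    (S : {vspace U}) (T : {vspace V}) : {vspace tensor U V} :=
  <<[seq u *t v | u <- vbasis S, v <- vbasis T]>>%VS.

(** * Finite-dimensional Hopf algebras *)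

HB.mixin Record Falgebra_isHopf (k : fieldType) H of Falgebra k H := {
  comul : {lrmorphism H -> tensor H H};
  counit : {lrmorphism H -> k^o};
  antipode : {linear H -> H};
  coassoc : forall h,
    tlift (fun u v => u *t comul v) (comul h) =
    tlift (fun u v => tlift (fun u1 u2 => u1 *t (u2 *t v)) (comul u)) (comul h)
      :> tensor H (tensor H H);
  counitl : forall h, tlift (fun u v => (counit u : k) *: v) (comul h) = h;
  counitr : forall h, tlift (fun u v => (counit v : k) *: u) (comul h) = h;
  antipodel : forall h,
    tlift (fun u v => antipode u * v) (comul h) = (counit h : k)%:A;
  antipoder : forall h,
    tlift (fun u v => u * antipode v) (comul h) = (counit h : k)%:A
}.

#[short(type="hopfAlgType")]
HB.structure Definition HopfAlgebra (k : fieldType) :=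
  { H of Falgebra k H & Falgebra_isHopf k H }.

Definition grouplike (k : fieldType) (H : hopfAlgType k) (g : H) : Prop :=
  g != 0 /\ comul g = g *t g.

(* [skew_primitive g h c] means that [c] belongs to $P_{g,h}$. *)
Definition skew_primitive (k : fieldType) (H : hopfAlgType k) (g h c : H) :
    Prop :=
  comul c = c *t g + h *t c.

(** * The coradical filtration *)

Section FamilySum.
Context {k : fieldType} {V : vectType k}.
Implicit Type P : set {vspace V}.

(* The sum of a possibly infinite family of subspaces. *)
Definition sumv_family P : {vspace V} :=
  xget 0%VS [set U : {vspace V} | forall v, v \in U <->
    exists2 s : seq {vspace V}, (forall C, C \in s -> P C)
                              & v \in (\sum_(C <- s) C)%VS].

Lemma mem_sumv_family P v :
  v \in sumv_family P <->
  exists2 s : seq {vspace V}, (forall C, C \in s -> P C)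
                            & v \in (\sum_(C <- s) C)%VS.
Proof.
pose Q (U : {vspace V}) := forall v, v \in U <->
  exists2 s : seq {vspace V}, (forall C, C \in s -> P C)
                            & v \in (\sum_(C <- s) C)%VS.
suff /(xgetPex 0%VS) : exists U, Q U by exact.
pose D (d : nat) := `[< exists2 s : seq {vspace V}, (forall C, C \in s -> P C)
                                        & \dim (\sum_(C <- s) C)%VS = d >].
have D0 : exists d, D d.
  by exists (\dim (\sum_(C <- [::] : seq {vspace V}) C)%VS); apply/asboolP; exists [::].
have Dmax d : D d -> (d <= \dim {:V})%N.
  by move=> /asboolP[s _ <-]; apply/dimvS/subvf.
case: (ex_maxnP D0 Dmax) => d /asboolP[s Ps sd] maxd.
exists (\sum_(C <- s) C)%VS; rewrite /Q /= => w; split=> [ws|[s' Ps' ws']]; first by exists s.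
suff -> : (\sum_(C <- s) C = \sum_(C <- s ++ s') C)%VS.
  by rewrite big_cat; apply: (subvP (addvSr _ _)).
apply/eqP; rewrite eqEdim; apply/andP; split.
  by rewrite big_cat; apply: addvSl.
rewrite sd; apply: maxd; apply/asboolP; exists (s ++ s') => // C.
by rewrite mem_cat => /orP[/Ps|/Ps'].
Qed.

End FamilySum.

Section Coradical.
Context {k : fieldType} (H : hopfAlgType k).

Definition subcoalgebra (C : {vspace H}) : Prop :=
  forall c, c \in C -> comul c \in tensv C C.

Definition simple_subcoalgebra (C : {vspace H}) : Prop :=
  [/\ subcoalgebra C, C != 0%VS &
      forall D : {vspace H}, subcoalgebra D -> (D <= C)%VS -> D = 0%VS \/ D = C].

Definition coradical : {vspace H} :=
  sumv_family [set C | simple_subcoalgebra C].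

Definition coradical1 : {vspace H} :=
  (linfun comul @^-1: (tensv fullv coradical + tensv coradical fullv))%VS.

Definition pointed : Prop :=
  forall C : {vspace H}, simple_subcoalgebra C -> \dim C = 1.

(* $k \otimes_{H_0} H_1$ is the quotient of $k \otimes H_1$ by the span of the
   elements $1 a \otimes m - 1 \otimes a m$, where $1 a = \epsilon(a)$, with
   $a \in H_0$ and $m \in H_1$. *)
Definition balancing : {vspace tensor k^o H} :=
  <<[seq counit a *t m - (1 : k^o) *t (a * m)
    | a <- vbasis coradical, m <- vbasis coradical1]>>%VS.

Definition dim_k_otimes_H1 : nat :=
  (\dim (tensv {:k^o} coradical1) - \dim balancing)%N.

Definition has_rank (t : nat) : Prop := dim_k_otimes_H1 = t.+1.

Definition skew_point (a : H) : Prop :=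
  grouplike a /\
  exists2 x, skew_primitive a 1 x & x \notin coradical.

End Coradical.

Definition hopf_isomorphic (k : fieldType) (H K : hopfAlgType k) : Prop :=
  exists f : {lrmorphism H -> K},
    [/\ bijective f,
        forall h, comul (f h) = tmap f f (comul h),
        forall h, counit (f h) = counit h &
        forall h, antipode (f h) = f (antipode h)].

(** * The Hopf algebras $H_R$ and $H_F$ *)

Definition linear_char (k : fieldType) (gT : finGroupType) (chi : gT -> k) :
    Prop :=
  (forall g, chi g != 0) /\ {morph chi : g h / (g * h)%g >-> g * h}.

(* The basis element [g] of the group algebra $kG$, whose elements are given by
   their coordinates. *)
Definition kG_elt (k : fieldType) (gT : finGroupType) (g : gT) :
    {ffun gT -> k^o} :=
  [ffun h => (h == g)%:R].

(* [iota] embeds $G$ in [H], with elements [g x^i], [g \in G], [i < n], that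
   form a basis of [H], and the Hopf structure of [H] is the one that $H_R$
   and $H_F$ have in common. *)
Record skew_extension (k : fieldType) (H : hopfAlgType k) (gT : finGroupType)
    (a : gT) (n : nat) (iota : gT -> H) (x : H) : Prop := SkewExtension {
  ske_1 : iota 1%g = 1;
  ske_M : {morph iota : g h / (g * h)%g >-> g * h};
  ske_basis :
    basis_of {:H} [seq iota g * x ^+ i | g <- enum gT, i <- seq.iota 0 n];
  ske_comul : forall g i, (i < n)%N -> comul (iota g * x ^+ i) =
    (iota g *t iota g) * (x *t iota a + 1 *t x) ^+ i;
  ske_counit : forall g i, (i < n)%N -> counit (iota g * x ^+ i) = (i == 0%N)%:R;
  ske_antipode : forall g i, (i < n)%N ->
    antipode (iota g * x ^+ i) = (- x * iota a^-1%g) ^+ i * iota g^-1%g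
}.

Record datumR (k : fieldType) (p : nat) := DatumR {
  dR_gT : finGroupType;
  dR_chi : dR_gT -> k;
  dR_a : dR_gT;
  dR_r : nat;
  dR_alpha_m1 : k;
  dR_alpha : 'I_dR_r -> k;
  dR_N : nat;
  dR_chiP : linear_char dR_chi;
  dR_a_central : dR_a \in 'Z([set: dR_gT])%g;
  dR_chi_a : dR_chi dR_a != 1;
  dR_NP : dR_N.-primitive_root (dR_chi dR_a);
  dR_n := (p ^ dR_r * dR_N)%N;
  dR_alpha_m1_0 : (dR_a ^+ dR_n)%g = 1%g -> dR_alpha_m1 = 0;
  dR_alphaP : forall i : 'I_dR_r, dR_alpha i != 0 ->
    (dR_a ^+ (dR_N * (p ^ dR_r - p ^ i)))%g = 1%g /\
    forall g, dR_chi g ^+ (dR_N * (p ^ dR_r - p ^ i)) = 1;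
  dR_alpha_m1P : dR_alpha_m1 != 0 -> forall g, dR_chi g ^+ (dR_N * p ^ dR_r) = 1
}.

Definition is_H_R (k : fieldType) (p : nat) (R : datumR k p)
    (H : hopfAlgType k) : Prop :=
  exists (iota : dR_gT R -> H) (x : H),
    [/\ skew_extension (dR_a R) (dR_n R) iota x,
        forall g, iota g * x * (iota g)^-1 = dR_chi g *: x &
        x ^+ dR_n R = dR_alpha_m1 R *: (iota (dR_a R) ^+ dR_n R - 1) +
          \sum_(i < dR_r R) dR_alpha i *: x ^+ (p ^ i * dR_N R)].

Record datumF (k : fieldType) (p : nat) := DatumF {
  dF_gT : finGroupType;
  dF_chi : dF_gT -> k;
  dF_c : dF_gT -> k;
  dF_a : dF_gT;
  dF_alpha_m1 : k;
  dF_alpha0 : k;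
  dF_chiP : linear_char dF_chi;
  dF_a_central : dF_a \in 'Z([set: dF_gT])%g;
  dF_chi_a : dF_chi dF_a = 1;
  dF_cP : forall g h, dF_c (h * g)%g = dF_chi g * dF_c h + dF_c g;
  dF_c_a : dF_c dF_a = 0;
  dF_alpha0P : dF_alpha0 = 0 \/ dF_alpha0 = 1;
  dF_alpha_m1_0 : dF_alpha0 = 0 -> dF_alpha_m1 = 0;
  dF_case0 : dF_alpha0 = 0 -> forall g,
    dF_c g *: (kG_elt k (dF_a ^+ p)%g - kG_elt k 1%g) = 0;
  dF_case1 : dF_alpha0 = 1 -> (dF_a ^+ p)%g = dF_a /\ forall g,
    (exists2 m : nat, (0 < m < p)%N & dF_chi g = m%:R) /\
    (dF_alpha_m1 * (dF_chi g - 1) + dF_c g ^+ p - dF_c g) *: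
      (kG_elt k dF_a - kG_elt k 1%g) = 0
}.

Definition is_H_F (k : fieldType) (p : nat) (F : datumF k p)
    (H : hopfAlgType k) : Prop :=
  exists (iota : dF_gT F -> H) (x : H),
    [/\ skew_extension (dF_a F) p iota x,
        forall g, iota g * x * (iota g)^-1 =
          dF_chi g *: x + dF_c g *: (iota (dF_a F) - 1) &
        x ^+ p = dF_alpha_m1 F *: (iota (dF_a F) ^+ p - 1) + dF_alpha0 F *: x].

(** * The two cases for a skew point *)

Definition case_i (k : fieldType) (H : hopfAlgType k) (a x : H) (q : k)
    (N : nat) : Prop :=
  [/\ skew_primitive a 1 x, x \notin coradical H,
      N.-primitive_root q & a * x * a^-1 = q *: x].

(* The second case has a genuine inhomogeneous term [a - 1]; without the
   condition [a != 1], it would coincide with [q = 1] in the first case when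
   [a = 1], as for the Hopf algebra $k[x]/(x^p)$ with [x] primitive. *)
Definition case_ii (k : fieldType) (H : hopfAlgType k) (a x : H) : Prop :=
  [/\ skew_primitive a 1 x, x \notin coradical H,
      a != 1 & a * x * a^-1 = x + (a - 1)].

Definition has_order (k : fieldType) (H : hopfAlgType k) (a : H) (m : nat) :
    Prop :=
  [/\ (0 < m)%N, a ^+ m = 1 &
      forall j : nat, (0 < j < m)%N -> a ^+ j <> 1].

(* Main.v *)
Require Import Defs.
From HB Require Import structures.
From mathcomp Require Import all_boot all_order all_fingroup all_algebra all_solvable all_field.
From mathcomp Require Import boolp.

(** The Hopf algebra [H] itself is shown to be of one of the two types, over the
    group [G] of its group-like elements.

    Since [H] is pointed, its coradical [H0] is the group algebra of [G], and the
    coproduct makes the quotient of [H1] by [H0] a comodule over [H0], that is, a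
    space graded by [G].  Left multiplication by [g] maps the component of degree
    [h] onto that of degree [g h], so dividing by the augmentation ideal of [H0]
    leaves the component of degree [1].  Rank one says that this component is the
    line spanned by a skew primitive [x] outside [H0] ([coinv_coradical1]).  It
    follows that [H1] is spanned by [G] and [G x] ([coradical1_sub]), and that
    every skew primitive element outside [H0] has the form [c x + t (a - 1)] and
    belongs to the same [a] as [x] ([skew_dichotomy]).

    Applied to the conjugates of [x], this shows that [a] is central and that
    [g x g^-1 = chi(g) x + c(g) (a - 1)] ([conj_x]).  For [g = a] the term
    [c(a) (a - 1)] can be absorbed into [x] when [chi(a) <> 1]; when [chi(a) = 1]
    it either vanishes or can be rescaled to [a - 1].  These are the two cases,
    and in the second one conjugation by [a^m] adds [m (a - 1)] to [x], so that
    the characteristic divides the order of [a].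

    Suppose now that [a x = q x a], and let [n] be the first positive index for
    which the Gaussian integer [1 + q + ... + q^(n-1)] vanishes: the order of [q]
    if [q <> 1], and [p] if [q = 1].  By the [q]-binomial theorem [x^n] is skew
    primitive for [a^n] ([skew_power]), so it is a multiple of [a^n - 1] or an
    element [s x + t (a - 1)] with [a^n = a]; conjugation by [a] excludes the
    latter if [q <> 1], and a rescaling or a translation of [x] normalises the
    relation if [q = 1].  The elements [g x^i] with [i < n] span [H] because [H1]
    generates it ([monomials_span]).  They are independent because contracting
    the coproduct of a relation of degree [m < n] leaves a relation of degree one
    whose leading coefficient is multiplied by the Gaussian integer of [m], which
    is not zero ([monomials_free]).  The remaining conditions on the data of [H_R]
    and [H_F] come from conjugating the relation on [x^n] by the elements of
    [G]. *)

Set Implicit Arguments.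
Unset Strict Implicit.
Unset Printing Implicit Defensive.

Import GRing.Theory.
Local Open Scope ring_scope.
Local Open Scope hopf_scope.

(** * Independent families and their dual functionals *)

Section IndependentFamilies.
Context {k : fieldType} {V : vectType k}.

Lemma span_map_sum (T : eqType) (f : T -> V) (l : seq T) v :
  uniq l -> v \in <<map f l>>%VS -> exists c, v = \sum_(t <- l) c t *: f t.
Proof.
elim: l v => [|t l IH] v /=.
  by rewrite span_nil memv0 => _ /eqP->; exists (fun=> 0); rewrite big_nil.
case/andP=> tl ul; rewrite span_cons => /memv_addP[u /vlineP[d ->] [w /(IH _ ul)[c ->] ->]].
exists (fun s => if s == t then d else c s); rewrite big_cons eqxx; congr (_ + _).
apply: eq_big_seq => s sl; case: eqP => // st.
by rewrite -st sl in tl.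
Qed.

(** Freeness of a list given as a family, so that coefficients can be indexed by
    the family rather than by the position in the list. *)
Lemma free_map (T : eqType) (f : T -> V) (l : seq T) :
    uniq l ->
    (forall c, \sum_(t <- l) c t *: f t = 0 -> {in l, forall t, c t = 0}) ->
  free (map f l).
Proof.
elim: l => [|t l IH] /=; first by rewrite nil_free.
case/andP=> tl ul ind; rewrite free_cons IH //; last first.
  move=> c c0 s sl.
  have := ind (fun s => if s == t then 0 else c s); rewrite big_cons eqxx scale0r add0r.
  move=> /(_ _ s); rewrite in_cons sl orbT; case: eqP => [st|_]; first by rewrite -st sl in tl.
  apply=> //; rewrite -[RHS]c0; apply: eq_big_seq => s' s'l; case: eqP => // s't.
  by rewrite -s't s'l in tl.
rewrite andbT; apply/negP => /(span_map_sum ul)[c ft].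
have := ind (fun s => if s == t then -1 else c s); rewrite big_cons eqxx => /(_ _ t).
rewrite eqxx in_cons eqxx => /(_ _ isT) h.
suff /h/eqP : -1 *: f t + \sum_(j <- l) (if j == t then -1 else c j) *: f j = 0.
  by rewrite oppr_eq0 oner_eq0.
rewrite scaleN1r ft addrC; apply/eqP; rewrite subr_eq0; apply/eqP.
apply: eq_big_seq => s sl; case: eqP => // st.
by rewrite -st sl in tl.
Qed.

Lemma sum_delta (T : eqType) (F : T -> V) (l : seq T) (t : T) :
  uniq l -> t \in l -> \sum_(s <- l) ((s == t)%:R : k) *: F s = F t.
Proof.
move=> ul tl; rewrite (big_rem t) //= eqxx scale1r big_seq big1 ?addr0 // => s.
by rewrite mem_rem_uniq // inE => /andP[/negPf-> _]; rewrite scale0r.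
Qed.

Lemma dual_functional (T : eqType) (f : T -> V) (l : seq T) (t : T) :
    uniq l -> free (map f l) -> t \in l ->
  exists phi : 'Hom(V, k^o), {in l, forall s, phi (f s) = (s == t)%:R}.
Proof.
move=> ul fl tl.
have it : (index t l < size (map f l))%N by rewrite size_map index_mem.
exists (linfun (coord (in_tuple (map f l)) (Ordinal it) : V -> k^o)) => s sl; rewrite lfunE /=.
have is_ : (index s l < size (map f l))%N by rewrite size_map index_mem.
have -> : f s = (in_tuple (map f l))`_(Ordinal is_).
  by rewrite /= (nth_map t) ?index_mem // nth_index.
rewrite coord_free // -val_eqE /=; congr (nat_of_bool _)%:R.
apply/eqP/eqP => [h|->//].
by rewrite -(nth_index t tl) -h nth_index.
Qed.

Lemma dim_add_line (v : V) (U : {vspace V}) :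
  v \notin U -> \dim (<[v]> + U) = (\dim U).+1.
Proof.
move=> vU; rewrite dimv_disjoint_sum ?dim_vline.
  by case: eqP vU => [->|]; rewrite ?mem0v.
apply/eqP; rewrite -subv0; apply/subvP => u; rewrite memv_cap memv0.
case/andP=> /vlineP[c ->]; case: (c =P 0) => [->|/eqP c0]; first by rewrite scale0r.
by rewrite rpredZeq (negPf c0) (negPf vU).
Qed.

End IndependentFamilies.

Lemma free_map_coef (k : fieldType) (V : vectType k) (T : eqType) (f : T -> V)
    (l : seq T) (c : T -> k) :
  uniq l -> free (map f l) -> \sum_(t <- l) c t *: f t = 0 ->
  {in l, forall t, c t = 0}.
Proof.
move=> ul fl c0 t tl; have [phi phiE] := dual_functional ul fl tl.
have := congr1 phi c0; rewrite linear0 linear_sum big_seq /= => E.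
rewrite -[LHS](sum_delta (V := k^o) (c : T -> k^o) ul tl) -[RHS]E big_seq.
by apply: eq_bigr => s sl; rewrite linearZ /= phiE // [LHS]mulrC.
Qed.

(** * Contractions of tensors *)

Definition contract (k : fieldType) (U V : vectType k) (f : 'Hom(U, k^o))
    (t : tensor U V) : V :=
  tlift (fun u v => (f u : k) *: v) t.

HB.instance Definition _ (k : fieldType) (U V : vectType k) (f : 'Hom(U, k^o)) :=
  GRing.Linear.copy (@contract k U V f) (tlift (fun u v => (f u : k) *: v)).

HB.instance Definition _ (k : fieldType) (U U' V V' : vectType k)
    (f : U -> U') (g : V -> V') :=
  GRing.Linear.copy (tmap f g) (tlift (fun u v => f u *t g v)).

Section Contraction.
Context {k : fieldType} {U V : vectType k}.
Implicit Types (f g : 'Hom(U, k^o)) (s t : tensor U V) (u : U).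

Lemma contractE f u (v : V) : contract f (u *t v) = (f u : k) *: v.
Proof.
rewrite /contract tlift_tens //; split=> [y c x1 x2|x c y1 y2].
  by rewrite linearP scalerDl scalerA.
by rewrite scalerDr !scalerA mulrC.
Qed.

Lemma contractP f c s t : contract f (c *: s + t) = c *: contract f s + contract f t.
Proof. exact: tlift_linear. Qed.

Lemma contractDl f g t : contract (f + g) t = contract f t + contract g t.
Proof.
elim/(@tensor_ind k U V): t => [u v|c s t hs ht].
  by rewrite !contractE lfunE /= scalerDl.
by rewrite !contractP hs ht scalerDr addrACA.
Qed.

Lemma contractZl c f t : contract (c *: f) t = c *: contract f t.
Proof.
elim/(@tensor_ind k U V): t => [u v|d s t hs ht].
  by rewrite !contractE lfunE /= scalerA.
by rewrite !contractP hs ht scalerDr !scalerA mulrC.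
Qed.

Lemma contractBl f g t : contract (f - g) t = contract f t - contract g t.
Proof. by rewrite -scaleN1r contractDl contractZl scaleN1r. Qed.

Lemma contract_suml (I : Type) (r : seq I) (F : I -> 'Hom(U, k^o)) t :
  contract (\sum_(i <- r) F i) t = \sum_(i <- r) contract (F i) t.
Proof.
elim/big_rec2: _ => [|i y f _ <-]; last by rewrite contractDl.
by rewrite -(scale0r (0 : 'Hom(U, k^o))) contractZl scale0r.
Qed.

Lemma tens_suml (I : Type) (r : seq I) (F : I -> U) (v : V) :
  (\sum_(i <- r) F i) *t v = \sum_(i <- r) F i *t v.
Proof.
pose h := HB.pack_for {linear U -> tensor U V} ((@tens k U V)^~ v)
  (GRing.isLinear.Build k U (tensor U V) _ _ (tens_linearl v)).
exact: (linear_sum h).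
Qed.

Lemma tensZl c u (v : V) : (c *: u) *t v = c *: (u *t v).
Proof.
pose h := HB.pack_for {linear U -> tensor U V} ((@tens k U V)^~ v)
  (GRing.isLinear.Build k U (tensor U V) _ _ (tens_linearl v)).
exact: (linearZZ h).
Qed.

Lemma tensDl u1 u2 (v : V) : (u1 + u2) *t v = u1 *t v + u2 *t v.
Proof. by have := tens_linearl v 1 u1 u2; rewrite !scale1r. Qed.

Lemma tensNl u (v : V) : (- u) *t v = - (u *t v).
Proof. by rewrite -scaleN1r tensZl scaleN1r. Qed.

Lemma tensZr c u (v : V) : u *t (c *: v) = c *: (u *t v).
Proof. exact: linearZZ. Qed.

Lemma tensDr u (v1 v2 : V) : u *t (v1 + v2) = u *t v1 + u *t v2.
Proof. exact: linearD. Qed.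

Lemma tensNr u (v : V) : u *t (- v) = - (u *t v).
Proof. exact: linearN. Qed.

Lemma mem_tens (S : {vspace U}) (T : {vspace V}) u v :
  u \in S -> v \in T -> u *t v \in tensv S T.
Proof.
move=> uS vT; rewrite (coord_vbasis uS) (coord_vbasis vT) tens_suml.
apply: memv_suml => i _; rewrite linear_sum; apply: memv_suml => j _.
rewrite /= tensZl linearZ; do 2!apply: memvZ; apply: memv_span.
by apply: allpairs_f; rewrite mem_nth // size_tuple.
Qed.

Lemma tensv_sub (S : {vspace U}) (T : {vspace V}) (X : {vspace tensor U V}) :
  (forall u v, u \in S -> v \in T -> u *t v \in X) -> (tensv S T <= X)%VS.
Proof.
move=> h; apply/span_subvP => _ /allpairsP[[u v] [/= uS vT ->]].
by apply: h; apply: vbasis_mem.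
Qed.

End Contraction.

Lemma tmapE (k : fieldType) (U U' V V' : vectType k) (f : {linear U -> U'})
  (g : {linear V -> V'}) u v : tmap f g (u *t v) = f u *t g v.
Proof.
rewrite /tmap tlift_tens //; split=> [y c x1 x2|x c y1 y2].
  by rewrite linearP tensDl tensZl.
by rewrite !linearP.
Qed.

Lemma tensX (k : fieldType) (A B : falgType k) (u : A) (v : B) n :
  (u *t v) ^+ n = u ^+ n *t v ^+ n.
Proof. by elim: n => [|n IH]; rewrite ?expr0 // !exprS IH tensM. Qed.

(** * Hitting, group-like elements and skew primitives *)

Section Hitting.
Context {k : fieldType} {H : hopfAlgType k}.
Implicit Types (f e : 'Hom(H, k^o)) (g h y : H).

(** The right action on [H] of its dual algebra. *)
Definition hit f h : H := contract f (comul h).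

HB.instance Definition _ f :=
  GRing.Linear.copy (hit f) (contract f \o comul).

Lemma hitBl f e h : hit (f - e) h = hit f h - hit e h.
Proof. exact: contractBl. Qed.

Lemma hitZl c f h : hit (c *: f) h = c *: hit f h.
Proof. exact: contractZl. Qed.

Lemma hit_suml (I : Type) (r : seq I) (F : I -> 'Hom(H, k^o)) h :
  hit (\sum_(i <- r) F i) h = \sum_(i <- r) hit (F i) h.
Proof. exact: contract_suml. Qed.

Lemma hit_counit h : hit (linfun counit) h = h.
Proof.
rewrite -[RHS]counitl /hit /contract /tlift.
by apply: eq_bigr => i _; apply: eq_bigr => j _; rewrite lfunE.
Qed.

Fact tens_comul_bilinear : bilinear_map (fun u v : H => u *t comul v).
Proof.
split=> [y c x1 x2|x c y1 y2]; first by rewrite tensDl tensZl.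
by rewrite !linearP.
Qed.

Fact tens3_bilinear (v : H) : bilinear_map (fun u1 u2 : H => u1 *t (u2 *t v)).
Proof.
split=> [y c x1 x2|x c y1 y2]; first by rewrite tensDl tensZl.
by rewrite tensDl tensZl !linearP.
Qed.

Fact comul_tens_bilinear :
  bilinear_map (fun u v : H => tlift (fun u1 u2 => u1 *t (u2 *t v)) (comul u)).
Proof.
split=> [y c x1 x2|x c y1 y2]; first by rewrite !linearP.
elim/(@tensor_ind k H H): (comul x) => [u v|d s t hs ht].
  by rewrite !tlift_tens; try exact: tens3_bilinear; rewrite !linearP.
rewrite !tlift_linear hs ht !scalerDr !scalerA mulrC.
by rewrite addrACA.
Qed.

(** By coassociativity, hitting is a map of right comodules. *)
Lemma comul_hit f h : comul (hit f h) = tmap (hit f) id (comul h).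
Proof.
have := congr1 (contract f) (coassoc h).
have -> : contract f (tlift (fun u v => u *t comul v) (comul h)) = comul (hit f h).
  rewrite /hit; elim/(@tensor_ind k H H): (comul h) => [u v|c s t hs ht].
    rewrite tlift_tens; last exact: tens_comul_bilinear.
    by rewrite !contractE linearZ.
  by rewrite tlift_linear !contractP hs ht linearP.
move=> ->; elim/(@tensor_ind k H H): (comul h) => [u v|c s t hs ht].
  rewrite tlift_tens; last exact: comul_tens_bilinear.
  rewrite (tmapE (hit f) idfun) /= /hit.
  elim/(@tensor_ind k H H): (comul u) => [u1 u2|c s t hs ht].
    rewrite tlift_tens; last exact: tens3_bilinear.
    by rewrite !contractE /= tensZl.
  by rewrite tlift_linear !contractP hs ht tensDl tensZl.
by rewrite tlift_linear contractP hs ht linearP.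
Qed.

Lemma contract_tmap (E : {linear H -> H}) f (t : tensor H H) :
  contract f (tmap E id t) = contract (linfun (f \o E)) t.
Proof.
elim/(@tensor_ind k H H): t => [u v|c s t hs ht].
  by rewrite (tmapE E idfun) !contractE lfunE.
by rewrite linearP !contractP hs ht.
Qed.

Lemma hit_hit f e h : hit f (hit e h) = hit (linfun (f \o hit e)) h.
Proof. by rewrite {1}/hit comul_hit contract_tmap. Qed.

(** The identity has the antipode as convolution inverse, so convolving with it
    is injective. *)
Lemma conv_id_inj (T : {linear H -> H}) :
  (forall z, tlift (fun u v => T u * v) (comul z) = 0) -> forall z, T z = 0.
Proof.
move=> T0 z.
have bT : bilinear_map (fun u v : H => T u * v).
  split=> [y c x1 x2|x c y1 y2]; first by rewrite linearP mulrDl scalerAl.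
  by rewrite mulrDr scalerAr.
have bS : bilinear_map (fun u v : H => u * antipode v).
  split=> [y c x1 x2|x c y1 y2]; first by rewrite mulrDl scalerAl.
  by rewrite linearP mulrDr scalerAr.
pose F (u : H) (w : tensor H H) := T u * tlift (fun u v => u * antipode v) w.
have bF : bilinear_map F.
  split=> [y c x1 x2|x c y1 y2]; rewrite /F; first by rewrite linearP mulrDl scalerAl.
  by rewrite tlift_linear mulrDr scalerAr.
have := congr1 (tlift F) (coassoc z).
have -> : tlift F (tlift (fun u v => u *t comul v) (comul z)) = T z.
  rewrite -[in RHS](counitr z).
  elim/(@tensor_ind k H H): (comul z) => [u v|c s t hs ht].
    rewrite tlift_tens; last exact: tens_comul_bilinear.
    rewrite !tlift_tens //; last first.
      split=> [y c x1 x2|x c y1 y2]; first by rewrite scalerDr !scalerA mulrC.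
      by rewrite linearP scalerDl scalerA.
    by rewrite /F antipoder linearZ /= -scalerAr mulr1.
  by rewrite !tlift_linear hs ht linearP.
move=> ->; elim/(@tensor_ind k H H): (comul z) => [u v|c s t hs ht].
  rewrite tlift_tens; last exact: comul_tens_bilinear.
  rewrite -[RHS](mul0r (antipode v)) -(T0 u).
  elim/(@tensor_ind k H H): (comul u) => [u1 u2|c s t hs ht].
    rewrite tlift_tens; last exact: tens3_bilinear.
    by rewrite tlift_tens // /F !tlift_tens // mulrA.
  by rewrite !tlift_linear hs ht mulrDl scalerAl.
by rewrite !tlift_linear hs ht scaler0 addr0.
Qed.

End Hitting.

Section Grouplikes.
Context {k : fieldType} {H : hopfAlgType k}.
Implicit Types (f e : 'Hom(H, k^o)) (g h y : H).

Lemma hit_grouplike f g : grouplike g -> hit f g = (f g : k) *: g.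
Proof. by case=> _ Dg; rewrite /hit Dg contractE. Qed.

Lemma grouplike_counit g : grouplike g -> counit g = 1 :> k.
Proof.
move=> gg; have := hit_counit g; rewrite hit_grouplike // lfunE /= => /eqP.
rewrite -subr_eq0 -[X in _ - X]scale1r -scalerBl scaler_eq0 (negPf gg.1) orbF.
by rewrite subr_eq0 => /eqP.
Qed.

Lemma grouplike1 : grouplike (1 : H).
Proof. by split; [exact: oner_neq0 | rewrite rmorph1]. Qed.

Lemma grouplikeM g h : grouplike g -> grouplike h -> grouplike (g * h).
Proof.
move=> gg gh; split; last by rewrite rmorphM /= gg.2 gh.2 tensM.
apply/eqP => gh0; have := oner_neq0 k.
have : counit (g * h) = 1 :> k by rewrite rmorphM /= !grouplike_counit // mulr1.
by rewrite gh0 linear0 => <-; rewrite eqxx.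
Qed.

Lemma antipode_mul_bilinear : bilinear_map (fun u v : H => antipode u * v).
Proof.
split=> [y c x1 x2|x c y1 y2]; first by rewrite linearP mulrDl scalerAl.
by rewrite mulrDr scalerAr.
Qed.

Lemma grouplike_antipode g : grouplike g -> antipode g * g = 1.
Proof.
move=> gg; have := antipodel g; rewrite gg.2 tlift_tens; last exact: antipode_mul_bilinear.
by rewrite grouplike_counit // scale1r.
Qed.

Lemma grouplike_antipoder g : grouplike g -> g * antipode g = 1.
Proof.
move=> gg; have := antipoder g; rewrite gg.2 tlift_tens; last first.
  split=> [y c x1 x2|x c y1 y2]; first by rewrite mulrDl scalerAl.
  by rewrite linearP mulrDr scalerAr.
by rewrite grouplike_counit // scale1r.
Qed.

Lemma grouplike_unit g : grouplike g -> g \is a GRing.unit.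
Proof.
move=> gg; apply/unitrP; exists (antipode g).
by rewrite grouplike_antipode ?grouplike_antipoder.
Qed.

Lemma antipode_grouplike g : grouplike g -> antipode g = g^-1.
Proof.
move=> gg; have ug := grouplike_unit gg.
by apply: (mulIr ug); rewrite mulVr // grouplike_antipode.
Qed.

Lemma grouplikeV g : grouplike g -> grouplike g^-1.
Proof.
move=> gg; have ug := grouplike_unit gg; split; first by rewrite invr_eq0; case: gg.
have u2 : comul g \is a GRing.unit by rewrite rmorph_unit.
apply: (mulIr u2); rewrite -rmorphM mulVr // rmorph1.
by rewrite gg.2 tensM mulVr.
Qed.

Lemma grouplikeX g n : grouplike g -> grouplike (g ^+ n).
Proof.
move=> gg; elim: n => [|n IH]; first by rewrite expr0; apply: grouplike1.
by rewrite exprS; apply: grouplikeM.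
Qed.

(** If [g] is a combination of independent group-like elements in which [h] has
    coefficient [c], contracting the coproduct of [g] with the functional dual to
    [h] gives both [c g] and [c h]; so [c] vanishes unless [g = h]. *)
Lemma grouplike_free (s : seq H) :
  uniq s -> (forall g, g \in s -> grouplike g) -> free s.
Proof.
elim: s => [|g s IH] /=; first by rewrite nil_free.
case/andP=> gs us gl; have fs : free s.
  by apply: IH => // h hs; apply: gl; rewrite inE hs orbT.
have gg : grouplike g by apply: gl; rewrite inE eqxx.
rewrite free_cons fs andbT; apply/negP; rewrite -[s]map_id => /(span_map_sum us)[c gE].
have fs' : free [seq id i | i <- s] by rewrite map_id.
case: (gg) => /eqP[]; rewrite gE big_seq big1 // => h hs.
have [phi phiE] := dual_functional us fs' hs.
have gh : grouplike h by apply: gl; rewrite inE hs orbT.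
have phig : (phi g : k) = c h.
  rewrite gE linear_sum /= big_seq (eq_bigr (fun i => (i == h)%:R *: (c i : k^o))).
    by rewrite -big_seq sum_delta.
  by move=> i si; rewrite linearZ /= phiE // [LHS]mulrC.
have : hit phi g = c h *: h.
  rewrite gE linear_sum /= big_seq (eq_bigr (fun i => (i == h)%:R *: (c i *: i))).
    by rewrite -big_seq sum_delta.
  move=> i si; rewrite linearZ /= hit_grouplike ?phiE // ?scalerA 1?mulrC //.
  by apply: gl; rewrite inE si orbT.
rewrite hit_grouplike // phig => /eqP; rewrite -subr_eq0 -scalerBr scaler_eq0.
case/orP=> [/eqP->|]; first by rewrite scale0r.
by rewrite subr_eq0 => /eqP gh'; rewrite gh' hs in gs.
Qed.

End Grouplikes.

(** * The group of group-like elements *)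

(** Group-like elements are independent, so there are at most [\dim H] of them and
    a longest duplicate-free list contains them all. *)
Lemma exists_grouplikes (k : fieldType) (H : hopfAlgType k) :
  exists s : seq H, uniq s /\ forall g, g \in s <-> grouplike g.
Proof.
pose P (n : nat) := `[< exists s : seq H,
  [/\ uniq s, forall g, g \in s -> grouplike g & size s = n] >].
have P0 : exists n, P n by exists 0%N; apply/asboolP; exists [::].
have Pmax n : P n -> (n <= \dim {:H})%N.
  move=> /asboolP[s [us gs <-]]; have := grouplike_free us gs.
  by rewrite /free => /eqP <-; apply/dimvS/subvf.
case: (ex_maxnP P0 Pmax) => n /asboolP[s [us gs sn]] maxn.
exists s; split=> // g; split=> [/gs//|gg]; apply: contraT => ngs.
have : P n.+1.
  apply/asboolP; exists (g :: s); split; rewrite /= ?ngs ?sn // => h.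
  by rewrite inE => /orP[/eqP->|/gs].
by move/maxn; rewrite ltnn.
Qed.

Definition grouplikes (k : fieldType) (H : hopfAlgType k) : seq H :=
  sval (cid (exists_grouplikes H)).

Definition grouplike_group (k : fieldType) (H : hopfAlgType k) : Type :=
  seq_sub (grouplikes H).

HB.instance Definition _ (k : fieldType) (H : hopfAlgType k) :=
  Finite.copy (grouplike_group H) (seq_sub (grouplikes H)).
HB.instance Definition _ (k : fieldType) (H : hopfAlgType k) :=
  SubType.copy (grouplike_group H) (seq_sub (grouplikes H)).

Section GrouplikeGroup.
Context {k : fieldType} {H : hopfAlgType k}.
Local Notation G := (grouplike_group H).

Lemma grouplikesP (g : H) : g \in grouplikes H <-> grouplike g.
Proof. exact: (svalP (cid (exists_grouplikes H))).2. Qed.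

Lemma grouplikes_uniq : uniq (grouplikes H).
Proof. exact: (svalP (cid (exists_grouplikes H))).1. Qed.

Lemma grouplikes_free : free (grouplikes H).
Proof. by apply: grouplike_free grouplikes_uniq _ => g /grouplikesP. Qed.

Lemma glP (g : G) : grouplike (val g).
Proof. exact/grouplikesP/valP. Qed.

Definition glgroup_elt (g : H) (gg : grouplike g) : G :=
  SeqSub (proj2 (grouplikesP g) gg).

Definition glgroup_mul (g h : G) : G := glgroup_elt (grouplikeM (glP g) (glP h)).
Definition glgroup_one : G := glgroup_elt grouplike1.
Definition glgroup_inv (g : G) : G := glgroup_elt (grouplikeV (glP g)).

Fact glgroup_mulA : associative glgroup_mul.
Proof. by move=> g h l; apply: val_inj; rewrite /= mulrA. Qed.
Fact glgroup_mul1 : left_id glgroup_one glgroup_mul.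
Proof. by move=> g; apply: val_inj; rewrite /= mul1r. Qed.
Fact glgroup_mulV : left_inverse glgroup_one glgroup_inv glgroup_mul.
Proof. by move=> g; apply: val_inj; rewrite /= mulVr // grouplike_unit //; apply: glP. Qed.

HB.instance Definition _ :=
  Finite_isGroup.Build G glgroup_mulA glgroup_mul1 glgroup_mulV.

Lemma gl_val1 : val (1%g : G) = 1.
Proof. by []. Qed.
Lemma gl_valM (g h : G) : val (g * h)%g = val g * val h.
Proof. by []. Qed.
Lemma gl_valV (g : G) : val (g^-1)%g = (val g)^-1.
Proof. by []. Qed.
Lemma gl_valX (g : G) n : val (g ^+ n)%g = val g ^+ n.
Proof. by elim: n => [|n IH]; rewrite ?expg0 ?expr0 // expgS exprS gl_valM IH. Qed.

Lemma gl_unit (g : G) : val g \is a GRing.unit.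
Proof. exact/grouplike_unit/glP. Qed.

Lemma map_val_enum_gl : perm_eq [seq val g | g : G] (grouplikes H).
Proof.
apply: uniq_perm; [by rewrite map_inj_uniq ?enum_uniq //; apply: val_inj | exact: grouplikes_uniq|].
move=> g; apply/mapP/idP => [[h _ ->]|gs]; first exact: valP.
by exists (SeqSub gs); rewrite ?mem_enum.
Qed.

Lemma gl_free : free [seq val g | g : G].
Proof. by rewrite (perm_free map_val_enum_gl) grouplikes_free. Qed.

Lemma exists_gl_dual (g : G) :
  exists phi : 'Hom(H, k^o), forall h : G, phi (val h) = (h == g)%:R.
Proof.
have [||phi phiE] := @dual_functional k H _ val _ g _ gl_free; rewrite ?enum_uniq ?mem_enum //.
by exists phi => h; rewrite phiE ?mem_enum.
Qed.

Definition gl_dual (g : G) : 'Hom(H, k^o) := sval (cid (exists_gl_dual g)).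

Lemma gl_dualE (g h : G) : gl_dual g (val h) = (h == g)%:R.
Proof. exact: (svalP (cid (exists_gl_dual g))). Qed.

(** A one-dimensional subcoalgebra is spanned by a vector [v] whose coproduct is a
    multiple [l] of [v (x) v]; the counit forces [l] to be nonzero, and then
    [l v] is group-like. *)
Lemma coradical_pointed : pointed H -> coradical H = <<grouplikes H>>%VS.
Proof.
move=> pH; apply/eqP; rewrite eqEsubv; apply/andP; split; last first.
  apply/span_subvP => g /grouplikesP gg; apply/mem_sumv_family.
  exists [:: <[g]>%VS]; last by rewrite big_seq1 memv_line.
  move=> C; rewrite inE => /eqP->; have dg : \dim <[g]> = 1%N by rewrite dim_vline gg.1.
  split.
  - move=> _ /vlineP[c ->]; rewrite linearZ /=; apply: memvZ; rewrite gg.2.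
    by apply: mem_tens; apply: memv_line.
  - by rewrite -dimv_eq0 dg.
  - move=> D _ sD; have := dimvS sD; rewrite dg; case E: (\dim D) => [|[|//]] _.
      by left; apply/eqP; rewrite -dimv_eq0 E.
    by right; apply/eqP; rewrite eqEdim sD dg E.
suff sub C : simple_subcoalgebra C -> (C <= <<grouplikes H>>)%VS.
  apply/subvP => v /mem_sumv_family[s ss]; apply: subvP.
  elim: s ss => [|C s IH] ss; first by rewrite big_nil sub0v.
  rewrite big_cons subv_add sub /=; last by apply: ss; rewrite inE eqxx.
  by apply: IH => D Ds; apply: ss; rewrite inE Ds orbT.
move=> sC; have dC := pH _ sC; case: sC => subC C0 _.
have c0 : vpick C != 0 by rewrite vpick0.
have CE : C = <[vpick C]>%VS.
  by apply/esym/eqP; rewrite eqEdim dim_vline c0 dC andbT -memvE memv_pick.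
have /vlineP[l cE] : comul (vpick C) \in <[vpick C *t vpick C]>%VS.
  have := subC _ (memv_pick C); apply: subvP; apply: tensv_sub => u v.
  rewrite {1 2}CE => /vlineP[d ->] /vlineP[e ->].
  by rewrite tensZl linearZ /=; do 2!apply: memvZ; apply: memv_line.
have l0 : l != 0.
  apply/eqP => l0; have := hit_counit (vpick C); rewrite /hit cE l0 scale0r linear0.
  by move/esym/eqP; rewrite (negPf c0).
have gg : grouplike (l *: vpick C).
  split; first by rewrite scaler_eq0 negb_or l0.
  by rewrite linearZ /= cE tensZl tensZr.
rewrite CE -memvE; have -> : vpick C = l^-1 *: (l *: vpick C).
  by rewrite scalerA mulVf // scale1r.
by apply/memvZ/memv_span/grouplikesP.
Qed.

End GrouplikeGroup.

(** * The coradical filtration of a pointed Hopf algebra *)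

Section Filtration.
Context {k : fieldType} {H : hopfAlgType k} (pH : pointed H).
Local Notation G := (grouplike_group H).
Local Notation H0 := (coradical H).
Local Notation H1 := (coradical1 H).
Implicit Types (g h : G) (b y z : H) (f : 'Hom(H, k^o)).

Lemma mem_gl g : val g \in H0.
Proof. by rewrite coradical_pointed //; apply/memv_span/valP. Qed.

Lemma mem_grouplike b : grouplike b -> b \in H0.
Proof. by move=> gb; rewrite coradical_pointed //; apply/memv_span/grouplikesP. Qed.

Lemma mem_coradical_sum y : y \in H0 -> exists c, y = \sum_(g : G) c g *: val g.
Proof.
rewrite coradical_pointed // -(eq_span (perm_mem map_val_enum_gl)).
move=> /(span_map_sum (enum_uniq _))[c ->]; exists c.
by rewrite big_enum.
Qed.

Lemma coradical_sub (U : {vspace H}) : (forall g, val g \in U) -> (H0 <= U)%VS.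
Proof.
move=> gU; apply/subvP => y /mem_coradical_sum[c ->].
by apply: memv_suml => g _; apply/memvZ/gU.
Qed.

Lemma hom_coradical_eq0 f : (forall g, f (val g) = 0) -> forall y, y \in H0 -> f y = 0.
Proof.
move=> f0 y /mem_coradical_sum[c ->]; rewrite linear_sum big1 // => g _.
by rewrite linearZ /= f0 scaler0.
Qed.

Lemma coradicalM y z : y \in H0 -> z \in H0 -> y * z \in H0.
Proof.
move=> /mem_coradical_sum[c ->] /mem_coradical_sum[d ->].
rewrite mulr_suml; apply: memv_suml => g _; rewrite mulr_sumr.
apply: memv_suml => h _; rewrite -scalerAl -scalerAr -gl_valM.
by do 2!apply: memvZ; apply: mem_gl.
Qed.

Lemma coradical1E : 1 \in H0.
Proof. exact: (mem_gl 1%g). Qed.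

Lemma mem_coradical1 y :
  (y \in H1) = (comul y \in (tensv {:H} H0 + tensv H0 {:H})%VS).
Proof. by rewrite -memv_preim lfunE. Qed.

(** The two lemmas that follow reduce membership statements about the subspace
    that defines [H1] to pure tensors with a factor in [H0]. *)
Lemma coradical1_tensor_ind (W : vectType k) (F : {linear tensor H H -> W}) (U : {vspace W}) :
    (forall u v, (u \in H0) || (v \in H0) -> F (u *t v) \in U) ->
  forall t, t \in (tensv {:H} H0 + tensv H0 {:H})%VS -> F t \in U.
Proof.
move=> FU t tin; rewrite -[F t](lfunE F) memv_preim; apply: subvP tin.
by rewrite subv_add; apply/andP; split; apply: tensv_sub => u v uH vH;
  rewrite -memv_preim lfunE; apply: FU; rewrite ?uH ?vH ?orbT.
Qed.

Lemma mem_coradical1_tensor (u v : H) : (u \in H0) || (v \in H0) ->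
  u *t v \in (tensv {:H} H0 + tensv H0 {:H})%VS.
Proof.
case/orP=> h; [apply: (subvP (addvSr _ _)) | apply: (subvP (addvSl _ _))];
  by apply: mem_tens; rewrite ?memvf.
Qed.

(** Modulo [H (x) H0], the coproduct of an element of [H1] lies in [H0 (x) H], and
    a functional that vanishes on [H0] only sees the remaining summand.  This is
    what turns [H1 / H0] into a left comodule over [H0]; the identities below
    between components of elements of [H1], which hold modulo [H0], all follow
    by comparing two functionals on [G]. *)
Lemma hit_coradical0 f y : (forall g, f (val g) = 0) -> y \in H1 -> hit f y \in H0.
Proof.
move=> f0; rewrite mem_coradical1 /hit; apply: coradical1_tensor_ind => u v.
rewrite /= contractE => /orP[uH|vH]; last exact: memvZ.
by rewrite (hom_coradical_eq0 f0) // scale0r mem0v.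
Qed.

Lemma hit_coradical f y : y \in H0 -> hit f y \in H0.
Proof.
move=> /mem_coradical_sum[c ->]; rewrite linear_sum; apply: memv_suml => g _.
rewrite linearZ /= hit_grouplike; last exact: glP.
by do 2!apply: memvZ; apply: mem_gl.
Qed.

Lemma hit_coradical1 f y : y \in H1 -> hit f y \in H1.
Proof.
rewrite !mem_coradical1 comul_hit; apply: coradical1_tensor_ind => u v uv.
rewrite /= (tmapE (hit f) idfun); apply: mem_coradical1_tensor.
by case/orP: uv => [/hit_coradical->//|->]; rewrite orbT.
Qed.

Lemma gl_mul_coradical1 g y : y \in H1 -> val g * y \in H1.
Proof.
rewrite !mem_coradical1 rmorphM /= (glP g).2.
apply: (@coradical1_tensor_ind _ ((val g *t val g : tensor H H) \*o idfun)).
move=> u v uv; rewrite /= tensM; apply: mem_coradical1_tensor.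
by apply/orP; case/orP: uv => h; [left|right]; apply: coradicalM h; apply: mem_gl.
Qed.

Lemma coradical_mul_coradical1 y z : y \in H0 -> z \in H1 -> y * z \in H1.
Proof.
move=> /mem_coradical_sum[c ->] zH; rewrite mulr_suml; apply: memv_suml => g _.
by rewrite -scalerAl; apply/memvZ/gl_mul_coradical1.
Qed.

Lemma coradical_sub1 : (H0 <= H1)%VS.
Proof.
apply: coradical_sub => g; rewrite mem_coradical1 (glP g).2.
by apply: mem_coradical1_tensor; rewrite mem_gl.
Qed.

(** Components for the grading of [H1] modulo [H0] given by the coaction of [H0]:
    they are only meaningful modulo [H0], since [gl_dual g] is an arbitrary
    extension from [H0] to [H]. *)
Definition component g y := hit (gl_dual g) y.
HB.instance Definition _ g := GRing.Linear.copy (component g) (hit (gl_dual g)).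

Lemma sum_component y : y \in H1 -> y - \sum_(g : G) component g y \in H0.
Proof.
move=> yH; rewrite -{1}(hit_counit y) /component -hit_suml -hitBl.
apply: hit_coradical0 => // h; rewrite add_lfunE opp_lfunE sum_lfunE lfunE /=.
rewrite grouplike_counit; last exact: glP.
rewrite (bigD1 h) //= gl_dualE eqxx big1 ?addr0 ?subrr // => g /negPf gh.
by rewrite gl_dualE eq_sym gh.
Qed.

Lemma component_component g h y : y \in H1 ->
  component h (component g y) - (h == g)%:R *: component g y \in H0.
Proof.
move=> yH; rewrite /component hit_hit -hitZl -hitBl.
apply: hit_coradical0 => // l; rewrite add_lfunE opp_lfunE scale_lfunE lfunE /=.
rewrite hit_grouplike ?linearZ /= ?gl_dualE; last exact: glP.
case: (l =P g) => [->|_]; last by rewrite scale0r oppr0 scaler0 addr0.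
rewrite scale1r scalerN (eq_sym h); apply/eqP; rewrite subr_eq0; apply/eqP.
exact/esym/mulr1.
Qed.

Lemma component_mul g h y : y \in H1 ->
  component g (val h * y) - val h * component (h^-1 * g)%g y \in H0.
Proof.
move=> yH; pose f := linfun (gl_dual g \o (val h \*o idfun)).
have -> : component g (val h * y) = val h * hit f y.
  rewrite /component /hit rmorphM /= (glP h).2.
  elim/(@tensor_ind k H H): (comul y) => [u v|c s t hs ht].
    by rewrite tensM !contractE lfunE /= scalerAr.
  by rewrite mulrDr -scalerAr !contractP hs ht mulrDr scalerAr.
rewrite -mulrBr; apply: coradicalM; first exact: mem_gl.
rewrite /component -hitBl; apply: hit_coradical0 => // l.
rewrite add_lfunE opp_lfunE lfunE /= -gl_valM !gl_dualE.
by rewrite (can2_eq (mulKg h) (mulKVg h)) subrr.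
Qed.

(** The projection, modulo [H0], of [H1] onto the component of degree [1] that
    moves every component there by a translation.  It identifies this component
    with the reduction of [H1 / H0] modulo the augmentation ideal of [H0]. *)
Definition coinv y := \sum_(g : G) val (g^-1)%g * component g y.

Fact coinv_linear : linear coinv.
Proof.
move=> c y z; rewrite /coinv scaler_sumr -big_split; apply: eq_bigr => g _ /=.
by rewrite linearP mulrDr scalerAr.
Qed.
HB.instance Definition _ := GRing.isLinear.Build k H H _ coinv coinv_linear.

Lemma coinv_mul h y : y \in H1 -> coinv (val h * y) - coinv y \in H0.
Proof.
move=> yH; rewrite /coinv (reindex_inj (mulgI h)) -sumrB; apply: memv_suml => g _.
have := component_mul (h * g)%g h yH; rewrite mulKg => /(coradicalM (mem_gl (h * g)^-1%g)).
by rewrite mulrBr mulrA -gl_valM invMg mulgKV.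
Qed.

Lemma coinv_coradical y : y \in H0 -> coinv y \in H0.
Proof.
move=> yH; apply: memv_suml => g _; apply: coradicalM; first exact: (mem_gl g^-1%g).
exact: hit_coradical.
Qed.

Lemma coinv_component g y : y \in H1 ->
  coinv (component g y) - val (g^-1)%g * component g y \in H0.
Proof.
move=> yH; rewrite /coinv (bigD1 g) //= addrAC; apply: memvD.
  have := component_component g g yH; rewrite eqxx scale1r => h.
  by rewrite -mulrBr; apply: coradicalM h; apply: (mem_gl g^-1%g).
apply: memv_suml => h /negPf hg; apply: coradicalM; first exact: (mem_gl h^-1%g).
by have := component_component g h yH; rewrite hg scale0r subr0.
Qed.

End Filtration.

(** * Rank one *)

Section Skew.
Context {k : fieldType} {H : hopfAlgType k} (pH : pointed H).
Local Notation G := (grouplike_group H).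
Local Notation H0 := (coradical H).
Local Notation H1 := (coradical1 H).
Implicit Types (g h : G) (b y z : H) (f : 'Hom(H, k^o)).

Lemma hit_skew f b y : skew_primitive b 1 y -> hit f y = (f y : k) *: b + (f 1 : k) *: y.
Proof. by move=> Dy; rewrite /hit Dy linearD /= !contractE. Qed.

Lemma skew_counit b y : grouplike b -> skew_primitive b 1 y -> counit y = 0 :> k.
Proof.
move=> gb sy; have := hit_skew (linfun counit) sy.
rewrite hit_counit !lfunE /= rmorph1 scale1r -{1}[y]add0r => /addIr/esym/eqP.
by rewrite scaler_eq0 (negPf gb.1) orbF => /eqP.
Qed.

Lemma skew_coradical1 b y : grouplike b -> skew_primitive b 1 y -> y \in H1.
Proof.
move=> gb sy; rewrite mem_coradical1 sy; apply: memvD; apply: mem_coradical1_tensor.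
  by rewrite orbC mem_grouplike.
by rewrite coradical1E.
Qed.

Lemma skewB b y z c : skew_primitive b 1 y -> skew_primitive b 1 z ->
  skew_primitive b 1 (y - c *: z).
Proof.
rewrite /skew_primitive => sy sz; rewrite linearB linearZ /= sy sz.
rewrite tensDl tensDr tensNl tensNr tensZl tensZr scalerDr opprD.
by rewrite addrACA.
Qed.

Lemma skewZ b y c : skew_primitive b 1 y -> skew_primitive b 1 (c *: y).
Proof.
by rewrite /skew_primitive => sy; rewrite linearZ /= sy tensZl tensZr scalerDr.
Qed.

Lemma skew_subr1 b : grouplike b -> skew_primitive b 1 (b - 1).
Proof.
move=> gb; rewrite /skew_primitive linearB /= gb.2 rmorph1.
by rewrite tensDl tensDr tensNl tensNr addrA subrK.
Qed.

(** On [H0] the component of degree [1] is a multiple [e y] of [1], while the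
    coproduct of a skew primitive element gives it as [e y *: b + y]. *)
Lemma skew_coradical b y : skew_primitive b 1 y -> y \in H0 ->
  exists c : k, y = c *: (b - 1).
Proof.
move=> sy yH; pose e := gl_dual (1%g : G); exists (- (e y : k)).
have := hit_skew e sy.
have -> : hit e y = (e y : k) *: 1.
  case: (mem_coradical_sum pH yH) => c ->; rewrite !linear_sum scaler_suml.
  apply: eq_bigr => g _; rewrite !linearZ /= hit_grouplike; last exact: glP.
  rewrite gl_dualE; case: eqP => [->|_]; last by rewrite !scaler0 !scale0r scaler0.
  by rewrite scale1r; congr (_ *: _); rewrite -[LHS]mulr1.
have -> : (e 1 : k) = 1 by rewrite -[1 in LHS]gl_val1 gl_dualE eqxx.
rewrite scale1r => E; rewrite scaleNr -scalerN opprB scalerBr E.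
by rewrite addrC addKr.
Qed.

Lemma coinv_skew b y : grouplike b -> skew_primitive b 1 y -> coinv y - y \in H0.
Proof.
move=> gb sy; rewrite /coinv /component.
have e1 g : (gl_dual g (1 : H) : k) = (g == 1%g)%:R.
  by rewrite -[1 in LHS]gl_val1 gl_dualE eq_sym.
rewrite (eq_bigr (fun g => val g^-1%g * ((gl_dual g y : k) *: b)
  + (g == 1%g)%:R *: (val g^-1%g * y))); last first.
  by move=> g _; rewrite (hit_skew _ sy) mulrDr e1; congr (_ + _); rewrite scalerAr.
rewrite big_split /=.
have -> : \sum_(g : G) (g == 1%g)%:R *: (val g^-1%g * y) = y.
  rewrite (bigD1 1%g) //= eqxx scale1r invr1 mul1r big1 ?addr0 // => g /negPf->.
  by rewrite scale0r.
rewrite addrK; apply: memv_suml => g _.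
apply: coradicalM => //; first exact: (mem_gl pH g^-1%g).
exact/memvZ/mem_grouplike.
Qed.

End Skew.

Section RankOne.
Context {k : fieldType} {H : hopfAlgType k} (pH : pointed H) (rkH : has_rank H 1).
Context {a x : H} (ga : grouplike a) (sx : skew_primitive a 1 x) (xH0 : x \notin coradical H).
Local Notation G := (grouplike_group H).
Local Notation H0 := (coradical H).
Local Notation H1 := (coradical1 H).
Implicit Types (g h : G) (b y z : H) (f : 'Hom(H, k^o)).

(** The product of the augmentation ideal of [H0] with [H1]: the tensor product of
    [k] and [H1] over [H0] is [H1] modulo [aug]. *)
Let aug : {vspace H} :=
  <<[seq (counit u : k) *: m - u * m | u <- vbasis H0, m <- vbasis H1]>>%VS.

Lemma rank_augmentation : dim_k_otimes_H1 H = (\dim H1 - \dim aug)%N.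
Proof.
pose theta := linfun (tens (1 : k^o) : H -> tensor k^o H).
have thI : lker theta == 0%VS.
  apply/lker0P => u v; rewrite !lfunE /= => uv.
  have := congr1 (contract (linfun (idfun : k^o -> k^o))) uv.
  by rewrite !contractE !lfunE /= !scale1r.
have dimt U : \dim (theta @: U) = \dim U.
  by apply: limg_dim_eq; rewrite (eqP thI) capv0.
rewrite /dim_k_otimes_H1 -(dimt H1) -(dimt aug).
have -> : tensv {:k^o} H1 = (theta @: H1)%VS.
  apply/eqP; rewrite eqEsubv; apply/andP; split.
    apply: tensv_sub => u v _ vH.
    have -> : u = (u : k) *: (1 : k^o) by rewrite -[LHS]mulr1.
    rewrite tensZl; apply: memvZ; apply/memv_imgP; exists v => //.
    by rewrite lfunE.
  apply/subvP => _ /memv_imgP[v vH ->]; rewrite lfunE /=.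
  by apply: mem_tens; rewrite ?memvf.
congr (_ - \dim _)%N; rewrite limg_span map_allpairs; congr (span _); apply: eq_allpairs => u m.
rewrite lfunE /= tensDr tensNr tensZr; congr (_ - _).
by rewrite -tensZl; congr (_ *t _); rewrite -[LHS]mulr1.
Qed.

Let aug_sub : (aug <= H1)%VS.
Proof.
apply/span_subvP => _ /allpairsP[[u m] [/= /vbasis_mem uH /vbasis_mem mH ->]].
by apply: memvB; [apply: memvZ | apply: coradical_mul_coradical1].
Qed.

Let coinv_aug y : y \in aug -> coinv y \in H0.
Proof.
rewrite -[coinv y](lfunE (@coinv k H)) memv_preim; apply: subvP.
apply/span_subvP => _ /allpairsP[[u m] [/= /vbasis_mem uH /vbasis_mem mH ->]].
rewrite -memv_preim lfunE /=; case: (mem_coradical_sum pH uH) => c ->.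
rewrite linear_sum scaler_suml mulr_suml -sumrB linear_sum.
apply: memv_suml => g _; rewrite linearZ /= grouplike_counit; last exact: glP.
rewrite -[X in _ *: m - X]scalerAl -[(c g *: 1 : k^o)]/(c g * 1) mulr1 -scalerBr linearZ /=.
by apply: memvZ; rewrite linearB -opprB memvN; apply: coinv_mul.
Qed.

Let counit_aug y : y \in aug -> counit y = 0 :> k.
Proof.
move=> yB; suff : y \in lker (linfun (@counit k H)) by rewrite memv_ker lfunE => /eqP.
apply: subvP yB; apply/span_subvP => _ /allpairsP[[u m] [_ _ ->]].
by rewrite memv_ker lfunE linearB linearZ rmorphM /= subrr.
Qed.

(** Rank one makes [1] and [x] a basis of [H1] modulo [aug], while [coinv] maps
    [aug] and [1] into [H0] and fixes [x] modulo [H0]. *)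
Lemma coinv_coradical1 y : y \in H1 -> exists c : k, coinv y - c *: x \in H0.
Proof.
move=> yH; have xB : x \notin aug.
  apply/negP => /coinv_aug cx; case/negP: xH0.
  by rewrite -[x](subKr (coinv x)); apply: memvB => //; apply: coinv_skew sx.
have oB : 1 \notin (<[x]> + aug)%VS.
  apply/negP => /memv_addP[u /vlineP[c ->] [v vB E]]; have := oner_neq0 k.
  have : counit (1 : H) = 1 :> k by rewrite rmorph1.
  rewrite {1}E linearD linearZ /= (skew_counit ga sx) (counit_aug vB) scaler0 addr0 => <-.
  by rewrite eqxx.
have xH1 := skew_coradical1 pH ga sx.
have : y \in (<[1%R]> + (<[x]> + aug))%VS.
  suff -> : (<[1%R : H]> + (<[x]> + aug))%VS = H1 by [].
  apply/eqP; rewrite eqEdim !subv_add -!memvE xH1 aug_sub !dim_add_line //.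
  rewrite (subvP (coradical_sub1 pH)) ?coradical1E //=.
  by move: rkH; rewrite /has_rank rank_augmentation => rk; have := leqnn 2; rewrite -{1}rk leq_subLR addn2.
case/memv_addP=> u /vlineP[c ->] [v /memv_addP[w /vlineP[d ->] [z zB ->]] ->].
exists d; rewrite 2!(linearD (@coinv k H)) 2!linearZ /= -addrA addrAC -scalerBr.
apply: memvD; first by apply/memvZ/coinv_coradical/coradical1E.
by apply: memvD; [apply/memvZ/(coinv_skew pH ga sx) | apply: coinv_aug].
Qed.

(** Each homogeneous component of [H1 / H0] is a translate of the component of
    degree [1], which is the line of [x]. *)
Lemma coradical1_sub (U : {vspace H}) :
  (H0 <= U)%VS -> (forall g, val g * x \in U) -> (H1 <= U)%VS.
Proof.
move=> HU gU; apply/subvP => y yH; rewrite -[y](subrK (\sum_(g : G) component g y)).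
apply: memvD; first by apply: (subvP HU); apply: sum_component.
apply: memv_suml => g _.
have cH : component g y \in H1 by apply: hit_coradical1.
have [c cx] := coinv_coradical1 cH; have := coinv_component pH g yH => h.
have : val g^-1%g * component g y - c *: x \in H0.
  by have := memvB cx h; rewrite opprB addrC addrA subrK.
move/(coradicalM pH (mem_gl pH g)); rewrite mulrBr mulrA -gl_valM mulgV mul1r -scalerAr.
by move/(subvP HU) => h'; have := memvD h' (memvZ c (gU g)); rewrite subrK.
Qed.

Lemma skew_line b y : grouplike b -> skew_primitive b 1 y ->
  exists c : k, y - c *: x \in H0.
Proof.
move=> gb sy; have yH := skew_coradical1 pH gb sy.
have [c cx] := coinv_coradical1 yH; exists c.
by have := memvB cx (coinv_skew pH gb sy); rewrite opprB addrC addrA subrK.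
Qed.

Lemma x_coradical (c : k) : (c *: x \in H0) = (c == 0).
Proof. by rewrite rpredZeq (negPf xH0) orbF. Qed.

(** A functional [f] that vanishes on [H0] with [f x = 1], applied to the coproduct
    of [y = c x + w] with [w] in [H0], gives [c b] because [y] is skew primitive,
    and [c a] because [x] is and [f] vanishes on [w]: hence [b = a] as soon as
    [c] is nonzero. *)
Lemma skew_dichotomy b y : grouplike b -> skew_primitive b 1 y ->
  (exists t : k, y = t *: (b - 1)) \/
  (b = a /\ exists c t : k, c != 0 /\ y = c *: x + t *: (a - 1)).
Proof.
move=> gb sy; have [c cx] := skew_line gb sy.
case: (c =P 0) cx => [->|/eqP c0 cx].
  by rewrite scale0r subr0 => yH; left; exact: (skew_coradical pH sy yH).
right; have fr : free (map id (x :: grouplikes H)).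
  by rewrite map_id free_cons grouplikes_free -coradical_pointed // xH0.
have ux : uniq (x :: grouplikes H) by apply: free_uniq; rewrite -[X in free X]map_id.
have [f fE] := dual_functional ux fr (mem_head _ _).
have fx : (f x : k) = 1 by rewrite fE ?mem_head // eqxx.
have f0 g : f (val g) = 0.
  rewrite fE; last by rewrite inE orbC (valP g : val g \in grouplikes H).
  by case: eqP => // gx; move: xH0; rewrite -gx mem_gl.
have f1 : (f 1 : k) = 0 := f0 1%g.
have yE : y = c *: x + (y - c *: x) by rewrite addrC subrK.
have hw : hit f (y - c *: x) = 0.
  case: (mem_coradical_sum pH cx) => d ->; rewrite linear_sum big1 // => g _.
  by rewrite linearZ /= hit_grouplike ?f0 ?scale0r ?scaler0 //; apply: glP.
have ab : b = a.
  have := hit_skew f sy; rewrite f1 scale0r addr0.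
  rewrite {1 2}yE (linearD (hit f)) /= hw (linearD f) /= (hom_coradical_eq0 pH f0 cx) !addr0 !linearZ /=.
  rewrite (hit_skew f sx) f1 scale0r addr0 fx scale1r.
  have -> : (c *: (1 : k^o) : k) = c by apply: mulr1.
  by move/(scalerI c0).
split=> //; move: sy; rewrite ab => sy.
have [t tE] := skew_coradical pH (skewB c sy sx) cx.
by exists c, t; rewrite -tE.
Qed.

Lemma skew_conj g b y : skew_primitive b 1 y ->
  skew_primitive (val g * b * (val g)^-1) 1 (val g * y * (val g)^-1).
Proof.
rewrite /skew_primitive => sy; have gV := glP g^-1%g.
rewrite !rmorphM /= sy (glP g).2 -gl_valV gV.2 mulrDr mulrDl !tensM mulr1.
by rewrite -gl_valM mulgV.
Qed.

(** The conjugate of [x] by [g] is a skew primitive element outside [H0], for the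
    conjugate of [a]. *)
Lemma conj_x g : val g * a * (val g)^-1 = a /\
  exists c t : k, c != 0 /\ val g * x * (val g)^-1 = c *: x + t *: (a - 1).
Proof.
have gc : grouplike (val g * a * (val g)^-1).
  by apply: grouplikeM; [apply: grouplikeM => //; apply: glP | apply: (glP g^-1%g)].
case: (skew_dichotomy gc (skew_conj g sx)) => // -[t xE].
have : val g * x * (val g)^-1 \in H0.
  by rewrite xE; apply/memvZ/memvB; rewrite ?coradical1E ?mem_grouplike.
move/(coradicalM pH (mem_gl pH g^-1%g)) => /coradicalM => /(_ pH _ (mem_gl pH g)).
by rewrite gl_valV !mulrA mulVr ?gl_unit // mul1r mulrVK ?gl_unit // (negPf xH0).
Qed.

(** When [a = 1] the coefficient [c] is undetermined; taking it to be zero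
    makes the cocycle identity of [H_F] hold in this case too. *)
Lemma exists_conj_data : exists chi c : G -> k, [/\
  forall g, val g * x * (val g)^-1 = chi g *: x + c g *: (a - 1),
  forall g, chi g != 0 & a = 1 -> forall g, c g = 0].
Proof.
have [chi chiP] := boolp.choice (fun g => (conj_x g).2).
have [c cP] := boolp.choice chiP.
exists chi, (fun g => if a == 1 then 0 else c g).
split=> [g|g|->]; [|by case: (cP g)|by rewrite eqxx].
have [_ ->] := cP g; case: eqP => // ->.
by rewrite subrr !scaler0.
Qed.

Lemma coef_inj (c c' t t' : k) :
  c *: x + t *: (a - 1) = c' *: x + t' *: (a - 1) ->
  c = c' /\ (a = 1 \/ t = t').
Proof.
have aH : a - 1 \in H0.
  by apply: memvB; rewrite ?coradical1E ?mem_grouplike.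
move=> E; have cc : c = c'.
  apply/eqP; rewrite -subr_eq0 -x_coradical scalerBl.
  have -> : c *: x - c' *: x = t' *: (a - 1) - t *: (a - 1).
    by apply/eqP; rewrite subr_eq addrAC eq_sym subr_eq addrC -E addrC.
  by apply: memvB; apply: memvZ.
split=> //; move: E; rewrite cc => /addrI/eqP; rewrite -subr_eq0 -scalerBl scaler_eq0.
by rewrite !subr_eq0 => /orP[/eqP|/eqP]; [right|left].
Qed.

End RankOne.

(** * The antipode on products *)

Section Antipode.
Context {k : fieldType} {H : hopfAlgType k}.
Implicit Types (g y z : H).

Let F (s : tensor H H) : H := tlift (fun u v => antipode u * v) s.

(** The maps sending [z] to [antipode (g * z) * g] and to [antipode z] have the same
    convolution product with the identity. *)
Lemma antipode_grouplikeM g z : grouplike g -> antipode (g * z) = antipode z * g^-1.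
Proof.
move=> gg; have ug := grouplike_unit gg; apply: (mulIr ug); rewrite mulrVK //.
pose T : {linear H -> H} := (g \o* (antipode \o (g \*o idfun))) \- (antipode : {linear H -> H}).
apply/eqP; rewrite -subr_eq0; apply/eqP; move: z; apply: (@conv_id_inj _ _ T) => z.
have bT : bilinear_map (fun u v => T u * v).
  split=> [y c x1 x2|y c x1 x2]; first by rewrite linearP mulrDl scalerAl.
  by rewrite mulrDr scalerAr.
have FT t : tlift (fun u v => T u * v) t = F (comul g * t) - F t.
  elim/(@tensor_ind k H H): t => [u v|c s t hs ht].
    by rewrite tlift_tens // gg.2 tensM /F !tlift_tens ?mulrBl ?mulrA //; apply: antipode_mul_bilinear.
  rewrite tlift_linear hs ht mulrDr -scalerAr /F !tlift_linear scalerBr opprD.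
  by rewrite addrACA.
by rewrite FT -rmorphM /F !antipodel rmorphM /= grouplike_counit // mul1r subrr.
Qed.

(** The map sending [z] to [antipode (x * z) * a + antipode z * x] has convolution
    product zero with the identity, because the counit vanishes at [x]. *)
Lemma antipode_skewM a x z : grouplike a -> skew_primitive a 1 x ->
  antipode (x * z) = antipode z * (- x * a^-1).
Proof.
move=> ga sx; have ua := grouplike_unit ga; apply: (mulIr ua).
rewrite -mulrA mulrVK // mulrN.
pose T : {linear H -> H} := (a \o* (antipode \o (x \*o idfun))) \+ (x \o* (antipode : {linear H -> H})).
apply/eqP; rewrite -addr_eq0; apply/eqP; move: z; apply: (@conv_id_inj _ _ T) => z.
have bT : bilinear_map (fun u v => T u * v).
  split=> [y c x1 x2|y c x1 x2]; first by rewrite linearP mulrDl scalerAl.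
  by rewrite mulrDr scalerAr.
have FT t : tlift (fun u v => T u * v) t = F (comul x * t).
  elim/(@tensor_ind k H H): t => [u v|c s t hs ht].
    rewrite tlift_tens // sx [_ * (u *t v)]mulrDl !tensM mul1r /F linearD /= !tlift_tens;
      try exact: antipode_mul_bilinear.
    by rewrite /T /= mulrDl !mulrA.
  by rewrite tlift_linear hs ht mulrDr -scalerAr /F tlift_linear.
by rewrite FT -rmorphM /F antipodel rmorphM /= (skew_counit ga sx) mul0r scale0r.
Qed.

End Antipode.

(** * Gaussian binomial coefficients *)

Section GaussianBinomial.
Context {k : fieldType} (q : k).

Definition qint n := \sum_(i < n) q ^+ i.

Fixpoint qbin n j {struct n} : k :=
  match n, j with
  | _, 0 => 1
  | 0, _.+1 => 0
  | n'.+1, j'.+1 => qbin n' j' + q ^+ j * qbin n' j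
  end.

Lemma qint0 : qint 0 = 0. Proof. exact: big_ord0. Qed.
Lemma qint1 : qint 1 = 1. Proof. by rewrite /qint big_ord1. Qed.
Lemma qintSr n : qint n.+1 = qint n + q ^+ n. Proof. exact: big_ord_recr. Qed.

Lemma qintD m n : qint (m + n) = qint m + q ^+ m * qint n.
Proof.
elim: n => [|n IH]; first by rewrite addn0 qint0 mulr0 addr0.
by rewrite addnS !qintSr IH mulrDr addrA exprD.
Qed.

Arguments qbin : simpl never.

Lemma qbinS n j : qbin n.+1 j.+1 = qbin n j + q ^+ j.+1 * qbin n j.+1.
Proof. by []. Qed.

Lemma qbin0 n : qbin n 0 = 1. Proof. by case: n. Qed.

Lemma qbin_small n j : (n < j)%N -> qbin n j = 0.
Proof.
elim: n j => [|n IH] [|j] //= nj.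
by rewrite qbinS !IH ?mulr0 ?addr0 // ltnW.
Qed.

Lemma qbinn n : qbin n n = 1.
Proof. by elim: n => // n IH; rewrite qbinS IH qbin_small ?mulr0 ?addr0. Qed.

Lemma qbin_pred n : qbin n.+1 n = qint n.+1.
Proof.
elim: n => [|n IH]; first by rewrite qint1.
by rewrite qbinS IH qbinn mulr1 -qintSr.
Qed.

Lemma qint_qbin n j : (j <= n)%N -> qint j.+1 * qbin n j.+1 = qint (n - j) * qbin n j.
Proof.
elim: n j => [|n IH] j; first by rewrite leqn0 => /eqP->; rewrite mulr0 qint0 mul0r.
rewrite leq_eqVlt => /orP[/eqP->|]; first by rewrite qbin_small // subnn qint0 mulr0 mul0r.
rewrite ltnS => jn.
have -> : qint j.+1 * qbin n.+1 j.+1 = qint n.+1 * qbin n j.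
  rewrite qbinS mulrDr mulrCA IH // mulrA -mulrDl -qintD addSn subnKC //.
case: j jn => [|i] jn; first by rewrite !qbin0 subn0.
rewrite subSS qbinS mulrDr -IH; last exact: ltnW.
rewrite mulrCA [_ * (qint _ * _)]mulrA -mulrDl -qintD addSn subnKC //.
exact: ltnW.
Qed.

(** The first vanishing Gaussian integer kills all the inner coefficients: this
    covers both the roots of unity and the Frobenius of the case [q = 1]. *)
Lemma qbin_eq0 n j : qint n = 0 -> (forall i, (0 < i < n)%N -> qint i != 0) ->
  (0 < j < n)%N -> qbin n j = 0.
Proof.
move=> n0 nz; case: j => // j /= jn.
have qj : qint j.+1 != 0 by apply: nz.
apply: (mulfI qj); rewrite mulr0 qint_qbin; last exact: ltnW (ltnW jn).
elim: j jn {qj} => [|j IH] jn; first by rewrite subn0 n0 mul0r.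
have qj : qint j.+1 != 0 by apply: nz; apply: ltnW.
suff -> : qbin n j.+1 = 0 by rewrite mulr0.
by apply: (mulfI qj); rewrite mulr0 qint_qbin ?IH // ltnW // ltnW // ltnW.
Qed.

Lemma q_binomial (A : algType k) (u v : A) n : u * v = q *: (v * u) ->
  (u + v) ^+ n = \sum_(j < n.+1) qbin n j *: (v ^+ (n - j) * u ^+ j).
Proof.
move=> uv; have ujv j : u ^+ j * v = q ^+ j *: (v * u ^+ j).
  elim: j => [|j IH]; first by rewrite !expr0 mul1r mulr1 scale1r.
  by rewrite [in LHS]exprS -mulrA IH -scalerAr (mulrA u) uv -scalerAl scalerA -exprSr -mulrA -exprS.
elim: n => [|n IH]; first by rewrite big_ord1 !expr0 mulr1 scale1r.
rewrite exprSr IH mulr_suml.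
rewrite (eq_bigr (fun j : 'I_n.+1 => qbin n j *: (v ^+ (n - j) * u ^+ j.+1)
   + (q ^+ j * qbin n j) *: (v ^+ (n.+1 - j) * u ^+ j))); last first.
  move=> j _; rewrite mulrDr -!scalerAl -!mulrA -exprSr ujv -scalerAr scalerA.
  by rewrite [q ^+ j * _]mulrC mulrA -exprSr subSn // -ltnS.
rewrite big_split [RHS]big_ord_recl /= qbin0 subn0.
rewrite [X in _ + X]big_ord_recl /= expr0 mul1r qbin0 subn0 addrCA; congr (_ + _).
rewrite [RHS](eq_bigr (fun i : 'I_n.+1 => qbin n i *: (v ^+ (n - i) * u ^+ i.+1)
   + (q ^+ i.+1 * qbin n i.+1) *: (v ^+ (n - i) * u ^+ i.+1))); last first.
  by move=> i _; rewrite /bump leq0n add1n subSS qbinS scalerDl.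
rewrite big_split /=; congr (_ + _).
rewrite big_ord_recr /= (@qbin_small n n.+1) // mulr0 scale0r addr0.
by apply: eq_bigr => i _; rewrite /bump leq0n add1n subSS.
Qed.

End GaussianBinomial.

Arguments qbin {k} q n j : simpl never.

Lemma qint_prim_root (k : fieldType) (q : k) N :
    q != 1 -> N.-primitive_root q ->
  qint q N = 0 /\ forall i, (0 < i < N)%N -> qint q i != 0.
Proof.
move=> q1 qN; have qintE i : (q - 1) * qint q i = q ^+ i - 1 by rewrite subrX1.
split=> [|i /andP[i0 iN]].
  apply: (mulfI (x := q - 1)); first by rewrite subr_eq0.
  by rewrite qintE prim_expr_order // subrr mulr0.
apply: contraTneq isT => qi; have : q ^+ i - 1 = 0 by rewrite -qintE qi mulr0.
move/eqP; rewrite subr_eq0 -(prim_order_dvd qN) => /(dvdn_leq i0).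
by rewrite leqNgt iN.
Qed.

Lemma qint_pchar (k : fieldType) p : p \in [pchar k] ->
  qint (1 : k) p = 0 /\ forall i, (0 < i < p)%N -> qint (1 : k) i != 0.
Proof.
move=> hp; have qintE i : qint (1 : k) i = i%:R.
  rewrite /qint (eq_bigr (fun=> 1)) ?sumr_const ?card_ord // => j _.
  by rewrite expr1n.
split=> [|i /andP[i0 ip]]; first by rewrite qintE (pcharf0 hp).
rewrite qintE -(dvdn_pcharf hp).
by apply/negP => /(dvdn_leq i0); rewrite leqNgt ip.
Qed.

(** * The monomial basis *)

Section MonomialIndices.
Context {k : fieldType} {H : hopfAlgType k}.
Local Notation G := (grouplike_group H).
Implicit Types (g : G) (x : H).

Definition monomial_index n : seq (G * nat) :=
  [seq (g, i) | g <- enum {: G}, i <- iota 0 n].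
Definition monomial (x : H) (t : G * nat) : H := val t.1 * x ^+ t.2.

Lemma mem_monomial_index n g i : ((g, i) \in monomial_index n) = (i < n)%N.
Proof.
apply/allpairsP/idP => [[[h j] [/= _ jn [_ ->]]]|i_n]; first by rewrite mem_iota in jn.
by exists (g, i); rewrite mem_enum mem_iota.
Qed.

Lemma monomial_index_uniq n : uniq (monomial_index n).
Proof. by apply: allpairs_uniq; rewrite ?enum_uniq ?iota_uniq // => -[g i] [h j]. Qed.

Lemma monomials_allpairs x n :
  map (monomial x) (monomial_index n) = [seq val g * x ^+ i | g <- enum {: G}, i <- iota 0 n].
Proof. by rewrite map_allpairs. Qed.

Lemma sum_monomialS n (W : zmodType) (F : G * nat -> W) :
  \sum_(t <- monomial_index n.+1) F t =
    \sum_(t <- monomial_index n) F t + \sum_(g : G) F (g, n).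
Proof.
rewrite !big_allpairs -big_enum -big_split; apply: eq_bigr => g _.
by rewrite -addn1 iotaD big_cat big_seq1.
Qed.

End MonomialIndices.

Section Monomials.
Context {k : fieldType} {H : hopfAlgType k} (pH : pointed H).
Context {a x : H} (ga : grouplike a) (sx : skew_primitive a 1 x) (xH0 : x \notin coradical H).
Local Notation G := (grouplike_group H).
Local Notation H0 := (coradical H).
Implicit Types (g h : G) (b y z : H) (f : 'Hom(H, k^o)).

Local Notation monomial := (monomial x).

Context (q : k) (axq : a * x = q *: (x * a)).

Lemma comul_x_powers n :
  comul (x ^+ n) = \sum_(j < n.+1) qbin q n j *: (x ^+ j *t (x ^+ (n - j) * a ^+ j)).
Proof.
rewrite rmorphXn /= sx (@q_binomial _ q) => [|]; last by rewrite !tensM !mul1r !mulr1 axq tensZr.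
apply: eq_bigr => j _; congr (_ *: _).
by rewrite !tensX tensM !expr1n mul1r.
Qed.

(** If [n] is the first index whose Gaussian integer vanishes, all the inner terms
    of the coproduct of [x ^+ n] vanish. *)
Lemma skew_power n : qint q n = 0 -> (forall i, (0 < i < n)%N -> qint q i != 0) ->
  (0 < n)%N -> skew_primitive (a ^+ n) 1 (x ^+ n).
Proof.
move=> n0 nz; case: n n0 nz => // n n0 nz _.
rewrite /skew_primitive comul_x_powers big_ord_recl big_ord_recr /= qbin0 qbinn !scale1r.
rewrite /bump leq0n add1n subnn subn0 !expr0 mulr1 mul1r [RHS]addrC; congr (_ + _).
rewrite big1 ?add0r // => i _.
by rewrite qbin_eq0 ?scale0r // leq0n add1n /= ltnS.
Qed.

Lemma gl_pow_coradical g n : val g * a ^+ n \in H0.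
Proof.
apply: mem_grouplike => //.
by apply: grouplikeM; [apply: glP | apply: grouplikeX].
Qed.

Lemma hit_monomial f g i :
  hit f (val g * x ^+ i) = \sum_(j < i.+1)
    qbin q i j *: ((f (val g * x ^+ j) : k) *: (val g * (x ^+ (i - j) * a ^+ j))).
Proof.
rewrite /hit rmorphM /= comul_x_powers (glP g).2 mulr_sumr linear_sum.
apply: eq_bigr => j _; rewrite -scalerAr linearZ /= tensM.
by rewrite contractE.
Qed.

(** By induction on the degree: contracting the coproduct of a relation of degree
    [m] with the functional dual to [g x ^+ (m - 1)] leaves, modulo [H0], only
    [g x a ^+ (m - 1)], with the coefficient of [g x ^+ m] in the relation times
    the Gaussian integer of [m].  As [x] is outside [H0], this vanishes. *)
Lemma monomials_free n :
  (forall i, (0 < i < n)%N -> qint q i != 0) -> free (map monomial (monomial_index n)).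
Proof.
elim: n => [|m IH] nz.
  rewrite /monomial_index; suff -> : [seq (g, i) | g <- enum {: G}, i <- iota 0 0] = [::].
    exact: nil_free.
  by elim: (enum _).
have {}IH : free (map monomial (monomial_index m)).
  by apply: IH => i /andP[i0 im]; apply: nz; rewrite i0 ltnW.
apply: free_map; first exact: monomial_index_uniq.
move=> c cs; have um := @monomial_index_uniq k H m.
suff cm g : c (g, m) = 0.
  move: (cs); rewrite sum_monomialS [X in _ + X]big1 ?addr0; last first.
    by move=> g _; rewrite cm scale0r.
  move=> /(free_map_coef um IH) c0 [g i]; rewrite mem_monomial_index ltnS leq_eqVlt.
  by case/orP=> [/eqP->|im] //; apply: c0; rewrite mem_monomial_index.
case: m => [|m] in nz IH cs um *.
  have := congr1 (gl_dual g) cs; rewrite linear0 sum_monomialS.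
  rewrite [X in X + _]big_seq big1 ?add0r; last by case=> h i; rewrite mem_monomial_index.
  rewrite linear_sum /monomial (bigD1 g) //= big1 ?addr0 => [|h /negPf hg].
    by rewrite linearZ expr0 mulr1 /= gl_dualE eqxx => /esym E; rewrite -[LHS]mulr1.
  by rewrite linearZ expr0 mulr1 /= gl_dualE hg scaler0.
have tm : (g, m) \in monomial_index m.+1 by rewrite mem_monomial_index.
have [f fE] := dual_functional um IH tm.
have fH h j : (j < m.+1)%N -> (f (val h * x ^+ j) : k) = ((h, j) == (g, m))%:R.
  by move=> jm; rewrite -(fE (h, j)) ?mem_monomial_index.
have low h i : (i < m.+1)%N -> hit f (val h * x ^+ i) \in H0.
  move=> im; rewrite hit_monomial; apply: memv_suml => j _.
  rewrite fH; last exact: leq_trans (ltn_ord j) im.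
  case: eqP => [[_ jm]|_]; last by rewrite scale0r scaler0 mem0v.
  have -> : (i - j = 0)%N by apply/eqP; rewrite subn_eq0 jm -ltnS.
  by do 2!apply: memvZ; rewrite expr0 mul1r; apply: gl_pow_coradical.
have top h : hit f (val h * x ^+ m.+1)
    - (qint q m.+1 * (h == g)%:R) *: (val g * (x * a ^+ m)) \in H0.
  rewrite hit_monomial 2!big_ord_recr /= subnn expr0 mul1r.
  rewrite fH // qbin_pred subSn // subnn expr1 scalerA xpair_eqE eqxx andbT.
  rewrite big1 ?add0r => [|j _]; last first.
    rewrite fH; last exact: leqW (ltn_ord j).
    by rewrite xpair_eqE (ltn_eqF (ltn_ord j)) andbF scale0r scaler0.
  case: (h =P g) => [->|_]; last by rewrite mulr0 !scale0r subr0 add0r; do 2!apply: memvZ; apply: gl_pow_coradical.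
  by rewrite addrAC subrr add0r; do 2!apply: memvZ; apply: gl_pow_coradical.
have : (c (g, m.+1) * qint q m.+1) *: (val g * (x * a ^+ m)) \in H0.
  have := congr1 (hit f) cs; rewrite linear0 sum_monomialS linearD /= => E.
  have l0 : hit f (\sum_(t <- monomial_index m.+1) c t *: monomial t) \in H0.
    rewrite linear_sum big_seq; apply: memv_suml => -[h i]; rewrite mem_monomial_index => im.
    by rewrite linearZ /=; apply/memvZ/low.
  have {}E : hit f (\sum_(h : G) c (h, m.+1) *: monomial (h, m.+1)) \in H0.
    by move/eqP: E; rewrite addr_eq0 => /eqP E; rewrite E memvN in l0.
  pose B := \sum_(h : G) c (h, m.+1) *: (hit f (val h * x ^+ m.+1)
    - (qint q m.+1 * (h == g)%:R) *: (val g * (x * a ^+ m))).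
  have BH : B \in H0 by apply: memv_suml => h _; apply/memvZ/top.
  have := memvB E BH; rewrite linear_sum -sumrB (bigD1 g) //= big1 => [|h /negPf hg].
    by rewrite addr0 linearZ -scalerBr /monomial /= subKr eqxx mulr1 scalerA.
  by rewrite linearZ -scalerBr /monomial /= subKr hg mulr0 scale0r scaler0.
rewrite rpredZeq => /orP[|xH].
  by rewrite mulf_eq0 (negPf (nz _ _)) ?ltnSn // orbF => /eqP.
case/negP: xH0; have gm := mem_grouplike pH (grouplikeV (grouplikeX m ga)).
have := coradicalM pH (coradicalM pH (mem_gl pH g^-1%g) xH) gm.
by rewrite gl_valV mulKr ?gl_unit // mulrK // grouplike_unit //; apply: grouplikeX.
Qed.

End Monomials.

(** * Generation and the Hopf structure on monomials *)

Section Generation.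
Context {k : fieldType} {H : hopfAlgType k} (pH : pointed H) (rkH : has_rank H 1).
Context {a x : H} (ga : grouplike a) (sx : skew_primitive a 1 x) (xH0 : x \notin coradical H).
Local Notation G := (grouplike_group H).
Local Notation H0 := (coradical H).
Local Notation H1 := (coradical1 H).
Local Notation A := (glgroup_elt ga).
Implicit Types (g h : G) (b y z : H).

(** The span of the monomials is stable under left multiplication by [G], and by
    [x] because [x] can be moved past [G] at the cost of lower terms and
    [x ^+ n] reduces; hence it is stable under [H1]. *)
Lemma monomials_span (chi c : G -> k) (s : k) n :
    agenv H1 = fullv ->
    (forall g, val g * x * (val g)^-1 = chi g *: x + c g *: (a - 1)) ->
    (1 < n)%N -> x ^+ n - s *: x \in H0 ->
  <<map (monomial x) (monomial_index n)>>%VS = fullv.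
Proof.
move=> gen conj n1 xn; set W := <<_>>%VS.
have Wm g i : (i < n)%N -> val g * x ^+ i \in W.
  move=> i_n; apply: memv_span; apply/mapP; exists (g, i) => //.
  by rewrite mem_monomial_index.
have H0W : (H0 <= W)%VS.
  by apply: coradical_sub => // g; rewrite -[val g]mulr1 -(expr0 x) Wm // ltnW.
have gW g v : v \in W -> val g * v \in W.
  rewrite -{1}[val g * v](lfunE (val g \*o idfun)) memv_preim; apply: subvP.
  apply/span_subvP => _ /mapP[[h i] + ->]; rewrite mem_monomial_index => i_n.
  by rewrite -memv_preim lfunE /= mulrA -gl_valM Wm.
have xW v : v \in W -> x * v \in W.
  rewrite -{1}[x * v](lfunE (x \*o idfun)) memv_preim; apply: subvP.
  apply/span_subvP => _ /mapP[[h i] + ->]; rewrite mem_monomial_index => i_n.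
  rewrite -memv_preim lfunE /= /monomial /=.
  have := conj h^-1%g; rewrite gl_valV invrK => E.
  have -> : x * (val h * x ^+ i) = chi h^-1%g *: (val h * x ^+ i.+1)
      + c h^-1%g *: (val (h * A)%g * x ^+ i - val h * x ^+ i).
    have -> : x * (val h * x ^+ i) = val h * ((val h)^-1 * x * val h) * x ^+ i.
      by rewrite !mulrA mulrV ?gl_unit // mul1r.
    rewrite E mulrDr mulrDl -!scalerAr -!scalerAl exprS mulrA; congr (_ + _ *: _).
    by rewrite mulrBr mulrBl mulr1.
  apply: memvD; apply: memvZ; last by apply: memvB; apply: Wm.
  move: i_n; rewrite leq_eqVlt => /orP[/eqP->|]; last exact: Wm.
  apply: gW; rewrite -[x ^+ n](subrK (s *: x)); apply: memvD; first exact: (subvP H0W).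
  by apply: memvZ; rewrite -[x]mul1r -[x in 1 * x]expr1; apply: (Wm 1%g).
have H1W : (H1 * W <= W)%VS.
  apply/prodvP => u v uH vW.
  rewrite -[u * v](lfunE (v \o* idfun)) memv_preim.
  apply: (subvP _ _ uH); apply: (coradical1_sub pH rkH ga sx xH0).
    by apply: coradical_sub => // g; rewrite -memv_preim lfunE; apply: gW.
  by move=> g; rewrite -memv_preim lfunE /= -mulrA; apply/gW/xW.
have W1 : (1 <= W)%VS by rewrite -memvE (subvP H0W) // coradical1E.
by apply/eqP; rewrite eqEsubv subvf -gen agenv_sub_modl.
Qed.

Lemma skew_extension_monomials n :
  basis_of {:H} (map (monomial x) (monomial_index n)) ->
  skew_extension A n (fun g : G => val g) x.
Proof.
move=> bas; have ex0 := skew_counit ga sx.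
split=> //.
- by rewrite -monomials_allpairs.
- by move=> g i _; rewrite rmorphM rmorphXn /= sx (glP g).2.
- move=> g i _; rewrite rmorphM rmorphXn /= ex0 grouplike_counit; last exact: glP.
  by rewrite mul1r expr0n.
- move=> g i _; rewrite antipode_grouplikeM; last exact: glP.
  congr (_ * _); elim: i => [|i IH].
    by rewrite !expr0 antipode_grouplike ?invr1 //; apply: grouplike1.
  by rewrite exprS (antipode_skewM _ ga sx) IH exprSr.
Qed.

Lemma hopf_isomorphic_refl : hopf_isomorphic H H.
Proof.
exists (idfun : {lrmorphism H -> H}); split=> //; first by exists id.
move=> h /=; elim/(@tensor_ind k H H): (comul h) => [u v|c s t hs ht].
  by rewrite (tmapE idfun idfun).
by rewrite linearP /= -hs -ht.
Qed.

End Generation.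

(** * Skew primitives up to scaling and translation *)

Lemma conjX (R : unitRingType) (u y : R) n :
  u \is a GRing.unit -> (u * y * u^-1) ^+ n = u * y ^+ n * u^-1.
Proof.
move=> uu; elim: n => [|n IH]; first by rewrite !expr0 mulr1 mulrV.
by rewrite !exprS IH -!mulrA mulKr.
Qed.

Section Normalisation.
Context {k : fieldType} {H : hopfAlgType k} (pH : pointed H).
Context {a x : H} (ga : grouplike a) (sx : skew_primitive a 1 x) (xH0 : x \notin coradical H).
Local Notation G := (grouplike_group H).
Local Notation H0 := (coradical H).

Lemma skew_affine (s t : k) : s != 0 ->
  skew_primitive a 1 (s *: x + t *: (a - 1)) /\ s *: x + t *: (a - 1) \notin H0.
Proof.
move=> s0; split.
  rewrite -[t]opprK scaleNr; apply: skewB; first exact: skewZ.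
  exact: skew_subr1.
have aH : t *: (a - 1) \in H0.
  by apply/memvZ/memvB; rewrite ?coradical1E ?mem_grouplike.
apply/negP => h; have := memvB h aH; rewrite addrK x_coradical //.
exact/negP.
Qed.

Lemma conj_affine (s t : k) y : a * x * a^-1 = y ->
  a * (s *: x + t *: (a - 1)) * a^-1 = s *: y + t *: (a - 1).
Proof.
have ua := grouplike_unit ga => <-.
rewrite mulrDr mulrDl -!scalerAr -!scalerAl; congr (_ + _ *: _).
by rewrite mulrBr mulrBl mulr1 mulrV // mulrK.
Qed.

Lemma grouplike_has_order : has_order a #[glgroup_elt ga]%g.
Proof.
split; first exact: order_gt0.
  by rewrite -[a]/(val (glgroup_elt ga)) -gl_valX expg_order.
move=> j /andP[j0 jm] aj; have : (#[glgroup_elt ga]%g %| j)%N.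
  by rewrite order_dvdn; apply/eqP/val_inj; rewrite gl_valX.
by move/(dvdn_leq j0); rewrite leqNgt jm.
Qed.

(** Conjugation by [a ^+ m] adds [m] times [a - 1] to [x]. *)
Lemma unipotent_pchar_order p : p \in [pchar k] -> a != 1 ->
  a * x * a^-1 = x + (a - 1) -> (p %| #[glgroup_elt ga]%g)%N.
Proof.
move=> hp a1 ax; have ua := grouplike_unit ga; have [_ am _] := grouplike_has_order.
have {}ax : a * x = (x + (a - 1)) * a by rewrite -ax mulrVK.
have powers m : a ^+ m * x = (x + (a - 1) *+ m) * a ^+ m.
  elim: m => [|m IH]; first by rewrite !expr0 mul1r mulr1 mulr0n addr0.
  rewrite [in LHS]exprS -mulrA IH mulrA mulrDr ax [a * ((a - 1) *+ m)]mulrnAr exprS mulrA.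
  congr (_ * _); rewrite mulrS [X in _ = X * a]addrA [RHS]mulrDl mulrnAl; congr (_ + _ *+ _).
  by rewrite mulrBr mulrBl mulr1 mul1r.
have := powers #[glgroup_elt ga]%g; rewrite am mul1r mulr1 => /eqP.
rewrite -subr_eq0 opprD addNKr oppr_eq0 -scaler_nat scaler_eq0 subr_eq0 (negPf a1) orbF.
by rewrite (dvdn_pcharf hp).
Qed.

End Normalisation.

(** * Roots of polynomials *)

Lemma exists_nth_root (k : closedFieldType) n (b : k) : (0 < n)%N -> exists r, r ^+ n = b.
Proof.
move=> n0; have [r rE] := solve_monicpoly (fun i => if i == 0%N then b else 0) n0.
exists r; rewrite rE; case: n n0 {rE} => // n _.
rewrite big_ord_recl /= expr0 mulr1 big1 ?addr0 // => i _.
by rewrite mul0r.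
Qed.

(** The [p] elements of the prime field already exhaust the roots of [X^p - X]. *)
Lemma frobenius_fixed (k : fieldType) p (b : k) :
  p \in [pchar k] -> b != 0 -> b ^+ p = b ->
  exists2 m : nat, (0 < m < p)%N & b = m%:R.
Proof.
move=> hp b0 bp; have pp := pcharf_prime hp; have p1 := prime_gt1 pp.
pose P : {poly k} := 'X^p - 'X.
have sP : size P = p.+1.
  by rewrite size_polyDl size_polyXn // size_polyN size_polyX ltnS.
have P0 : P != 0 by rewrite -size_poly_eq0 sP.
pose rs : seq k := [seq m%:R | m <- iota 0 p].
have rsP : all (root P) rs.
  apply/allP => _ /mapP[m _ ->]; rewrite rootE !hornerE.
  by rewrite -[X in X - _](pFrobenius_autE hp) pFrobenius_aut_nat subrr.
have urs : uniq rs.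
  rewrite map_inj_in_uniq ?iota_uniq // => i j; rewrite !mem_iota !add0n /=.
  wlog ij : i j / (i <= j)%N => [hw ip jp E|ip jp E].
    by case: (leqP i j) => [/hw->|/ltnW/hw->].
  have : (p %| j - i)%N by rewrite (dvdn_pcharf hp) natrB // E subrr.
  case: (posnP (j - i)%N) => [/eqP|ji0 /(dvdn_leq ji0)].
    by rewrite subn_eq0 => ji _; apply/eqP; rewrite eqn_leq ij.
  by rewrite leqNgt (leq_ltn_trans (leq_subr _ _) jp).
have /mapP[m] : b \in rs.
  apply: contraT => brs; have : (size (b :: rs) < size P)%N.
    apply: max_poly_roots; rewrite //= ?brs // rsP andbT.
    by rewrite rootE !hornerE bp subrr.
  by rewrite sP /= size_map size_iota ltnn.
rewrite mem_iota add0n => /andP[_ mp] bE; exists m => //; rewrite mp andbT lt0n.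
by apply: contra b0 => /eqP m0; rewrite bE m0.
Qed.

(** * The two types *)

Section Types.
Context {k : closedFieldType} {p : nat} (hp : p \in [pchar k]).
Context {H : hopfAlgType k} (pH : pointed H) (rkH : has_rank H 1).
Context (gen : agenv (coradical1 H) = fullv).
Context {a : H} (ga : grouplike a).
Local Notation G := (grouplike_group H).
Local Notation H0 := (coradical H).
Local Notation A := (glgroup_elt ga).
Implicit Types (g h : G) (x y z : H).

Let ua : a \is a GRing.unit := grouplike_unit ga.

Lemma pchar_falg : p \in [pchar H].
Proof. by rewrite pchar_lalg. Qed.

Lemma frobenius_conj (s t : k) x : a * x = x * a ->
  (s *: x + t *: (a - 1)) ^+ p = s ^+ p *: x ^+ p + t ^+ p *: (a ^+ p - 1).
Proof.
move=> ax; have hpH := pchar_falg.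
rewrite -(pFrobenius_autE hpH) pFrobenius_autD_comm; last first.
  rewrite /GRing.comm -!scalerAl -!scalerAr !scalerA mulrC.
  by rewrite mulrBr mulrBl ax mulr1 mul1r.
rewrite !pFrobenius_autE !exprZn; congr (_ + _ *: _).
by rewrite -(pFrobenius_autE hpH) pFrobenius_autB_comm ?pFrobenius_autE ?expr1n //; apply: commr1.
Qed.

Lemma gl_central x : skew_primitive a 1 x -> x \notin H0 ->
  A \in 'Z([set: G])%g.
Proof.
move=> sx xH0; apply/centerP; split; first exact: in_setT.
move=> g _; apply: val_inj => /=; have [E _] := conj_x pH rkH ga sx xH0 g.
by rewrite -{1}E mulrVK // gl_unit.
Qed.

Lemma chi_morph x (chi c : G -> k) :
    skew_primitive a 1 x -> x \notin H0 ->
    (forall g, val g * x * (val g)^-1 = chi g *: x + c g *: (a - 1)) ->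
  forall g h, chi (g * h)%g = chi g * chi h /\
    (a = 1 \/ c (h * g)%g = chi g * c h + c g).
Proof.
move=> sx xH0 conj.
have conja g : val g * (a - 1) * (val g)^-1 = a - 1.
  have [E _] := conj_x pH rkH ga sx xH0 g.
  by rewrite mulrBr mulrBl E mulr1 mulrV // gl_unit.
have E g h : chi (g * h)%g = chi g * chi h /\
    (a = 1 \/ c (g * h)%g = chi h * c g + c h).
  apply: (coef_inj pH ga xH0); rewrite -conj gl_valM.
  have -> : val g * val h * x * (val g * val h)^-1 =
      val g * (val h * x * (val h)^-1) * (val g)^-1.
    by rewrite invrM ?gl_unit // !mulrA.
  rewrite conj mulrDr mulrDl -!scalerAr -!scalerAl conj conja scalerDr !scalerA.
  by rewrite -addrA -scalerDl mulrC.
by move=> g h; split; [case: (E g h) | case: (E h g)].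
Qed.

(** Since [q] differs from [1], comparing the conjugates by [a g] and [g a] kills
    the inhomogeneous terms of the action of [G], and conjugating [x ^+ N] by
    [a], which fixes it, excludes that it involves [x]. *)
Lemma type_R x (q : k) (N : nat) : case_i a x q N -> q <> 1 ->
  exists (R : datumR k p) (K : hopfAlgType k),
    [/\ dR_r R = 0%N, is_H_R R K & hopf_isomorphic H K].
Proof.
case=> sx xH0 qN axq /eqP q1.
have x0 : x != 0 by apply: contraNneq xH0 => ->; apply: mem0v.
have N0 := prim_order_gt0 qN.
have N1 : (1 < N)%N.
  rewrite ltn_neqAle N0 andbT; apply: contra q1 => /eqP N1.
  by move: (prim_expr_order qN); rewrite -N1 expr1 => ->.
have [qn0 qnz] := qint_prim_root q1 qN.
have a1 : a <> 1.
  move=> a1; move: axq; rewrite a1 invr1 mul1r mulr1 => /eqP.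
  rewrite -subr_eq0 -{1}[x]scale1r -scalerBl scaler_eq0 (negPf x0) orbF subr_eq0.
  by rewrite eq_sym (negPf q1).
have axq' : a * x = q *: (x * a) by rewrite scalerAl -axq mulrVK.
have [chi [c [conj chi0 _]]] := exists_conj_data pH rkH ga sx xH0.
have chiM := chi_morph sx xH0 conj.
have chiA : chi A = q.
  have E : chi A *: x + c A *: (a - 1) = q *: x + 0 *: (a - 1).
    by rewrite -conj axq scale0r addr0.
  by have [] := coef_inj pH ga xH0 E.
have c0 g : c g = 0.
  have [_ [//|]] : chi g * q = q * chi g /\ (a = 1 \/ c g = q * c g).
    apply: (coef_inj pH ga xH0); rewrite -!scalerA -(conj_affine ga _ _ axq).
    rewrite -scalerDr -conj.
    have [ag _] := conj_x pH rkH ga sx xH0 g.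
    have {}ag : val g * a = a * val g by rewrite -{2}ag mulrVK ?gl_unit.
    have agV : (val g)^-1 * a^-1 = a^-1 * (val g)^-1.
      by rewrite -!invrM ?gl_unit // ag.
    have -> : a * (val g * x * (val g)^-1) * a^-1 = val g * (a * x * a^-1) * (val g)^-1.
      by rewrite !mulrA -ag -!mulrA agV.
    by rewrite axq -scalerAr -scalerAl.
  move/eqP; rewrite -subr_eq0 -{1}[c g]mul1r -mulrBl mulf_eq0 subr_eq0 eq_sym (negPf q1).
  by move/eqP.
have conj' g : val g * x * (val g)^-1 = chi g *: x by rewrite conj c0 scale0r addr0.
have sxN := skew_power sx axq' qn0 qnz N0.
have [t tE] : exists t : k, x ^+ N = t *: (a ^+ N - 1).
  case: (skew_dichotomy pH rkH ga sx xH0 (grouplikeX N ga) sxN) => // -[_ [s [t [s0 xNE]]]].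
  have := conjX x N ua; rewrite axq exprZn prim_expr_order // scale1r {2}xNE.
  rewrite (conj_affine ga _ _ axq) xNE scalerA => /(coef_inj pH ga xH0)[/eqP].
  rewrite -subr_eq0 -{1}[s]mulr1 -mulrBr mulf_eq0 (negPf s0) subr_eq0 eq_sym.
  by rewrite (negPf q1).
(* When [a ^+ N = 1] the coefficient [t] is arbitrary, and must be taken zero. *)
pose alpha := if a ^+ N == 1 then 0 else t.
have xN : x ^+ N = alpha *: (a ^+ N - 1).
  by rewrite tE /alpha; case: eqP => // ->; rewrite subrr !scaler0.
have chiN g : alpha != 0 -> chi g ^+ N = 1.
  rewrite {1}/alpha; case: (a ^+ N =P 1) => [|/eqP aN t0]; first by rewrite eqxx.
  have := conjX x N (gl_unit g); rewrite conj' exprZn tE => E.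
  have := conj_x pH rkH ga sx xH0 g => -[ag _].
  have : chi g ^+ N *: (t *: (a ^+ N - 1)) = t *: (a ^+ N - 1).
    rewrite E -scalerAr -scalerAl mulrBr mulrBl -conjX ?gl_unit // ag.
    by rewrite mulr1 mulrV ?gl_unit.
  move/eqP; rewrite -subr_eq0 -{2}[t *: _]scale1r -scalerBl !scaler_eq0 (negPf t0).
  by rewrite !subr_eq0 (negPf aN) !orbF => /eqP.
have xNs : x ^+ N - 0 *: x \in H0.
  rewrite scale0r subr0 xN; apply/memvZ/memvB; rewrite ?coradical1E //.
  by apply: mem_grouplike => //; apply: grouplikeX.
have bas : basis_of {:H} (map (monomial x) (monomial_index N)).
  rewrite /basis_of (monomials_span pH rkH ga sx xH0 gen conj N1 xNs) eqxx /=.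
  exact: (monomials_free pH ga sx xH0 axq').
have chiP : linear_char chi by split=> // g h; have [] := chiM g h.
pose n := (p ^ 0 * N)%N; have nN : n = N by rewrite /n expn0 mul1n.
have R1 : chi A != 1 by rewrite chiA.
have R2 : N.-primitive_root (chi A) by rewrite chiA.
have R3 : (A ^+ n)%g = 1%g -> alpha = 0.
  by rewrite nN /alpha => /(congr1 val); rewrite gl_valX => ->; rewrite eqxx.
have R4 (i : 'I_0) : 0 != 0 :> k -> (A ^+ (N * (p ^ 0 - p ^ i)))%g = 1%g /\
  forall g, chi g ^+ (N * (p ^ 0 - p ^ i)) = 1 by case: i.
have R5 : alpha != 0 -> forall g, chi g ^+ (N * p ^ 0) = 1.
  by move=> al g; rewrite expn0 muln1 chiN.
exists (DatumR chiP (gl_central sx xH0) R1 R2 R3 R4 R5), H; split=> //.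
  exists (fun g : G => val g), x; split=> //=.
  - by rewrite [dR_n _]nN; apply: skew_extension_monomials.
  - by rewrite [dR_n _]nN big_ord0 addr0.
exact: hopf_isomorphic_refl.
Qed.

(** The conditions on [chi] and [c] express that conjugation by [g] respects the
    relation on [x ^+ p], whose conjugate the Frobenius map computes. *)
Lemma type_F_normalised x (alpha_m1 alpha0 : k) :
    skew_primitive a 1 x -> x \notin H0 -> a * x = x * a ->
    x ^+ p = alpha_m1 *: (a ^+ p - 1) + alpha0 *: x ->
    (alpha0 = 0 /\ alpha_m1 = 0) \/ (alpha0 = 1 /\ a ^+ p = a) ->
  exists (F : datumF k p) (K : hopfAlgType k), is_H_F F K /\ hopf_isomorphic H K.
Proof.
move=> sx xH0 ax xp al.
have pp := pcharf_prime hp; have p1 := prime_gt1 pp.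
have axq : a * x = 1 *: (x * a) by rewrite scale1r.
have axa : a * x * a^-1 = x by rewrite ax mulrK.
have [_ qnz] := qint_pchar hp.
have [chi [c [conj chi0 c1]]] := exists_conj_data pH rkH ga sx xH0.
have chiM := chi_morph sx xH0 conj.
have [chiA cA] : chi A = 1 /\ (a = 1 \/ c A = 0).
  by apply: (coef_inj pH ga xH0); rewrite -conj axa scale1r scale0r addr0.
have {}cA : c A = 0 by case: cA => // /c1.
have xps : x ^+ p - alpha0 *: x \in H0.
  rewrite xp addrK; apply/memvZ/memvB; rewrite ?coradical1E //.
  by apply: mem_grouplike => //; apply: grouplikeX.
have bas : basis_of {:H} (map (monomial x) (monomial_index p)).
  rewrite /basis_of (monomials_span pH rkH ga sx xH0 gen conj p1 xps) eqxx /=.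
  exact: (monomials_free pH ga sx xH0 axq).
have conjp g : val g * x ^+ p * (val g)^-1 =
    chi g ^+ p *: x ^+ p + c g ^+ p *: (a ^+ p - 1).
  by rewrite -conjX ?gl_unit // conj frobenius_conj.
have kG (b b' : G) (t : k) : t *: (val b - val b') = 0 -> t *: (kG_elt k b - kG_elt k b') = 0.
  move/eqP; rewrite scaler_eq0 => /orP[/eqP->|]; first by rewrite scale0r.
  by rewrite subr_eq0 => /eqP/val_inj ->; rewrite subrr scaler0.
have F1 : alpha0 = 0 -> alpha_m1 = 0.
  by case: al => [[]|[-> _ /eqP]] //; rewrite oner_eq0.
have F2 : alpha0 = 0 -> forall g, c g *: (kG_elt k (A ^+ p)%g - kG_elt k 1%g) = 0.
  move=> al0 g; apply: kG; rewrite gl_valX.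
  have := conjp g; rewrite xp al0 F1 // !scale0r addr0 mulr0 mul0r scaler0 add0r.
  move/esym/eqP; rewrite !scaler_eq0 expf_eq0 prime_gt0 //= => /orP[/eqP->|/eqP->].
    by rewrite scale0r.
  by rewrite scaler0.
have F3 : alpha0 = 1 -> (A ^+ p)%g = A /\ forall g,
    (exists2 m : nat, (0 < m < p)%N & chi g = m%:R) /\
    (alpha_m1 * (chi g - 1) + c g ^+ p - c g) *: (kG_elt k A - kG_elt k 1%g) = 0.
  move=> al1; have ap : a ^+ p = a.
    by case: al => [[]|[]] //; rewrite al1 => /eqP; rewrite oner_eq0.
  split=> [|g]; first by apply: val_inj; rewrite gl_valX.
  have [ag _] := conj_x pH rkH ga sx xH0 g.
  have [chip E] : chi g ^+ p = chi g /\
      (a = 1 \/ chi g ^+ p * alpha_m1 + c g ^+ p = c g + alpha_m1).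
    apply: (coef_inj pH ga xH0); rewrite [in RHS]scalerDl addrA -conj.
    have := conjp g; rewrite xp al1 ap scale1r [chi g ^+ p *: _]scalerDr scalerA.
    rewrite addrAC -scalerDl addrC => <-.
    rewrite mulrDr mulrDl -scalerAr -scalerAl addrC mulrBr mulrBl ag mulr1 mulrV //.
    exact: gl_unit.
  split; first exact: frobenius_fixed.
  apply: kG => /=; case: E => [->|E]; first by rewrite subrr scaler0.
  suff -> : alpha_m1 * (chi g - 1) + c g ^+ p - c g = 0 by rewrite scale0r.
  transitivity (chi g ^+ p * alpha_m1 + c g ^+ p - (c g + alpha_m1)).
    rewrite chip mulrBr mulr1 mulrC opprD [RHS]addrA [RHS]addrAC; congr (_ - _).
    by rewrite addrAC.
  by rewrite E subrr.
have al01 : alpha0 = 0 \/ alpha0 = 1 by case: al => -[->]; [left|right].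
have chiP : linear_char chi by split=> // g h; have [] := chiM g h.
have cP g h : c (h * g)%g = chi g * c h + c g.
  have [_ [a1|//]] := chiM g h.
  by rewrite !c1 // mulr0 addr0.
exists (DatumF chiP (gl_central sx xH0) chiA cP cA al01 F1 F2 F3), H; split.
  exists (fun g : G => val g), x; split=> //=.
  exact: skew_extension_monomials.
exact: hopf_isomorphic_refl.
Qed.

(** If [x ^+ p] is a multiple of [a ^+ p - 1], translating [x] by a multiple of
    [a - 1] makes it vanish; otherwise [x ^+ p] has a nonzero component [s x],
    and a rescaling of [x] makes this coefficient [1]. *)
Lemma type_F x (N : nat) : case_i a x 1 N ->
  exists (F : datumF k p) (K : hopfAlgType k), is_H_F F K /\ hopf_isomorphic H K.
Proof.
case=> sx xH0 _; rewrite scale1r => axa.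
have ax : a * x = x * a by rewrite -{2}axa mulrVK.
have pp := pcharf_prime hp; have p0 := prime_gt0 pp.
have axq : a * x = 1 *: (x * a) by rewrite scale1r.
have [qp0 qnz] := qint_pchar hp.
have sxp := skew_power sx axq qp0 qnz p0.
have affC (s t : k) : a * (s *: x + t *: (a - 1)) = (s *: x + t *: (a - 1)) * a.
  by rewrite mulrDr mulrDl -!scalerAr -!scalerAl ax mulrBr mulrBl mulr1 mul1r.
case: (skew_dichotomy pH rkH ga sx xH0 (grouplikeX p ga) sxp) => [[t xp]|[ap [s [t [s0 xp]]]]].
  (* [mu] solves [(x + mu (a - 1)) ^+ p = 0]. *)
  have [mu muE] := exists_nth_root (- t) p0.
  have [sx' xH0'] := skew_affine pH ga sx xH0 mu (oner_neq0 k).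
  apply: (@type_F_normalised _ 0 0 sx' xH0' (affC _ _)); last by left.
  by rewrite frobenius_conj // expr1n scale1r xp muE scaleNr subrr !scale0r addr0.
have p10 : (0 < p.-1)%N by rewrite -ltnS prednK // prime_gt1.
(* [(l x) ^+ p] has [x]-component [l ^+ p s x], which is to be [l x]. *)
have [l lE] := exists_nth_root s^-1 p10.
have l0 : l != 0.
  apply/eqP => l0; move: lE; rewrite l0 expr0n eqn0Ngt p10 => /esym/eqP.
  by rewrite invr_eq0 (negPf s0).
have [sx' xH0'] := skew_affine pH ga sx xH0 0 l0.
apply: (@type_F_normalised _ (l ^+ p * t) 1 sx' xH0' (affC _ _)); last by right.
rewrite frobenius_conj // expr0n eqn0Ngt p0 !scale0r !addr0 scale1r xp ap addrC.
rewrite scalerDr !scalerA; congr (_ + _ *: _).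
by rewrite -[in LHS](prednK p0) exprS lE -mulrA mulVf // mulr1.
Qed.

End Types.

(** * The dichotomy *)

Section Dichotomy.
Context {k : closedFieldType} {H : hopfAlgType k} (pH : pointed H) (rkH : has_rank H 1).
Context {a : H}.
Local Notation H0 := (coradical H).

(** Write [c x + t (a - 1)] for the conjugate of [x] by [a].  If [c] is not [1],
    translating [x] by [t / (c - 1)] times [a - 1] gives an eigenvector; if [c]
    is [1], either [t (a - 1)] vanishes or [x / t] is as in the second case. *)
Lemma case_exists : skew_point a ->
  (exists x q N, case_i a x q N) \/ (exists x, case_ii a x).
Proof.
case=> ga [x sx xH0].
have [_ [c [t [c0 axa]]]] := conj_x pH rkH ga sx xH0 (glgroup_elt ga).
have [m0 am _] := grouplike_has_order ga.
have eigen y (q : k) : skew_primitive a 1 y -> y \notin H0 -> a * y * a^-1 = q *: y ->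
    exists x q N, case_i a x q N.
  move=> sy yH0 ay; set m := #[_]%g in m0 am.
  (* [a] has finite order, so its eigenvalues are roots of unity. *)
  have qm : q ^+ m = 1.
    have powers i : a ^+ i * y = q ^+ i *: (y * a ^+ i).
      elim: i => [|i IH]; first by rewrite !expr0 mul1r mulr1 scale1r.
      have ay' : a * y = q *: (y * a) by rewrite scalerAl -ay mulrVK // grouplike_unit.
      rewrite [in LHS]exprS -mulrA IH -scalerAr mulrA ay' -scalerAl scalerA -exprSr.
      by rewrite -mulrA -exprS.
    apply/eqP; have := powers m; rewrite am mul1r mulr1 => /eqP.
    rewrite -subr_eq0 -{1}[y]scale1r -scalerBl scaler_eq0 subr_eq0 eq_sym => /orP[//|y0].
    by rewrite (eqP y0) mem0v in yH0.
  have [N qN _] := prim_order_exists m0 qm.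
  by exists y, q, N.
case: (c =P 1) => [c1|/eqP c1]; last first.
  left; have [sy yH0] := skew_affine pH ga sx xH0 (t / (c - 1)) (oner_neq0 k).
  apply: (eigen _ c sy yH0); rewrite (conj_affine ga _ _ axa) !scale1r [RHS]scalerDr -addrA.
  congr (_ + _); rewrite scalerA -scalerDl; congr (_ *: _).
  have c1' : c - 1 != 0 by rewrite subr_eq0.
  rewrite -{1}[t](mulfVK c1') -{2}[t / (c - 1)]mulr1 -mulrDr subrK.
  exact: mulrC.
case: (a =P 1) => [a1|/eqP a1].
  by left; apply: (eigen x 1); rewrite // axa c1 a1 subrr scaler0 addr0.
case: (t =P 0) => [t0|/eqP t0].
  by left; apply: (eigen x 1); rewrite // axa c1 t0 scale0r addr0.
right; have tV0 : t^-1 != 0 by rewrite invr_eq0.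
have [sy yH0] := skew_affine pH ga sx xH0 0 tV0.
exists (t^-1 *: x + 0 *: (a - 1)); split=> //.
rewrite (conj_affine ga _ _ axa) c1 scale1r scale0r !addr0 scalerDr scalerA mulVf //.
by rewrite scale1r.
Qed.

Lemma case_exclusive : grouplike a ->
  ~ ((exists x q N, case_i a x q N) /\ (exists x, case_ii a x)).
Proof.
move=> ga [[x [q [N [sx xH0 _ axa]]]] [y [sy yH0 /eqP a1 aya]]].
case: (skew_dichotomy pH rkH ga sx xH0 ga sy) => [[t yE]|[_ [s [t [s0 yE]]]]].
  case/negP: yH0; rewrite yE.
  by apply/memvZ/memvB; rewrite ?coradical1E ?mem_grouplike.
move: aya; rewrite yE (conj_affine ga _ _ axa) -addrA -{3}[a - 1]scale1r.
rewrite -scalerDl scalerA => /(coef_inj pH ga xH0)[_ [//|/eqP]].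
by rewrite -subr_eq0 opprD addNKr oppr_eq0 oner_eq0.
Qed.

End Dichotomy.

Theorem theorem4p1 (k : closedFieldType) (p : nat) (hp : p \in [pchar k])
    (H : hopfAlgType k) (Hpointed : pointed H) (Hrank : has_rank H 1)
    (Hgen : agenv (coradical1 H) = fullv) (HH0 : coradical H <> fullv)
    (a : H) (ha : skew_point a) :
  [/\ ((exists x q N, case_i a x q N) \/ (exists x, case_ii a x)) /\
      ~ ((exists x q N, case_i a x q N) /\ (exists x, case_ii a x)),
      forall (x : H) (q : k) (N : nat), case_i a x q N ->
        (q <> 1 -> exists (R : datumR k p) (K : hopfAlgType k),
           [/\ dR_r R = 0%N, is_H_R R K & hopf_isomorphic H K]) /\
        (q = 1 -> exists (F : datumF k p) (K : hopfAlgType k),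
           is_H_F F K /\ hopf_isomorphic H K)
    & (exists x, case_ii a x) -> exists2 m, has_order a m & (p %| m)%N].
Proof.
have ga : grouplike a by case: ha.
split.
- split; [exact: (case_exists Hpointed Hrank ha) | exact: (case_exclusive Hpointed Hrank ga)].
- move=> x q N ci; split=> [q1|qE].
    exact: (type_R Hpointed Hrank Hgen ga ci q1).
  by rewrite qE in ci; exact: (type_F hp Hpointed Hrank Hgen ga ci).
- case=> x [sx xH0 a1 axa]; exists #[glgroup_elt ga]%g.
    exact: grouplike_has_order.
  exact: (unipotent_pchar_order ga hp a1 axa).
Qed.
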